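(* Consider the affine flag variety $\mathrm{SL}_2((t))/I$ of $\mathrm{SL}_2$ over $\mathbb{C}$, the subgroups $I_3\supset I_4$ of $I$, and the subsets $E_n^{\mathrm{o}},E_n^{\mathrm{h}}$ ($n\in\mathbb{Z}\setminus\{0\}$) and $O_n^{\mathrm{o}},O_n^{\mathrm{h}}$ ($n\in\mathbb{Z}$) of $\mathrm{SL}_2((t))/I$ given in the context. Then: (1) $E_n^{\mathrm{o}}$ for $n\neq 0$, and $E_n^{\mathrm{h}}$ for $n<0$, is an $I_3$-orbit. (2) $O_n^{\mathrm{o}}$ for $n\in\mathbb{Z}$, and $O_n^{\mathrm{h}}$ for $n<0$, is an $I_3$-orbit. (3) For $n>0$, $E_n^{\mathrm{h}}$ decomposes (as a disjoint union) into the $I_3$-orbits $$E_n^{\mathrm{ho}} := [n, \mathbb{C}^{\times}t^{-n+1}+\mathbb{C} t^{-n+2}+\dots + \mathbb{C} t^{n-1}] \cong \mathbb{G}_m \times \mathbb{A}^{2n-2},$$ $$E_n^{\mathrm{hh}} := [n, \mathbb{C} t^{-n+2}+\dots+\mathbb{C} t^{n-1}] \cong \mathbb{A}^{2n-2}.$$ In fact, $I_4\,[n,t^{-n+1}] \supseteq E_n^{\mathrm{ho}}$ and $I_4\,[n,0] \supseteq E_n^{\mathrm{hh}}$. (4) For $n>0$, $O_n^{\mathrm{h}}$ decomposes (as a disjoint union) into the $I_3$-orbits $$O_n^{\mathrm{ho}} := [n, \mathbb{C}^{\times}t^{-n+1}+\mathbb{C} t^{-n+2}+\dots + \mathbb{C}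 t^n]' \cong \mathbb{G}_m \times \mathbb{A}^{2n-1},$$ $$O_n^{\mathrm{hh}} := [n, \mathbb{C} t^{-n+2}+\dots + \mathbb{C} t^n]' \cong \mathbb{A}^{2n-1}.$$ In fact, $I_4\,[n,t^{-n+1}]' \supseteq O_n^{\mathrm{ho}}$ and $I_4\,[n,0]' \supseteq O_n^{\mathrm{hh}}$.
   Context: Everything is over $\mathbb{C}$, and only $\mathbb{C}$-points are considered. $\mathrm{SL}_2((t))$ is the group of $2\times 2$ matrices with entries in $\mathbb{C}((t))$ and determinant $1$. The standard Iwahori subgroup is $$I = \left\{\begin{pmatrix} a & b \\ tc & d\end{pmatrix} : a,b,c,d \in \mathbb{C}[[t]],\ ad-tbc = 1\right\}.$$ The quotient $\mathrm{SL}_2((t))/I$ is the affine flag variety (an ind-variety); $\mathrm{SL}_2((t))$ and its subgroups act on it by left multiplication. The following are subgroups of $I$: $$I_3 = \left\{\begin{pmatrix} a & t^2b \\ t^2c & d\end{pmatrix} : a,b,c,d \in \mathbb{C}[[t]],\ ad-t^4bc = 1\right\},$$ $$I_4 = \left\{\begin{pmatrix} \alpha(1+t^2a) & t^2b \\ t^2c & \alpha^{-1}(1+t^2d)\end{pmatrix} : \alpha \in \mathbb{C}^{\times},\ a, b, c, d \in \mathbb{C}[[t]],\ a+d+t^2(ad-bc)=0\right\}.$$ For $n\in\mathbb{Z}$ and $p\in\mathbb{C}[t,t^{-1}]$ that is $0$ or of degree (largest exponent) $<n$, write $[n,p]$ for the coset $\begin{pmatrix} t^n & p \\ 0 & t^{-n}\end{pmatrix}I$.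 For $n\in\mathbb{Z}$ and $p\in\mathbb{C}[t,t^{-1}]$ that is $0$ or of degree $\le n$, write $[n,p]'$ for the coset $\begin{pmatrix} p & t^n \\ -t^{-n} & 0\end{pmatrix}I$. Every element of $\mathrm{SL}_2((t))/I$ is of exactly one of these two forms, for unique $n$ and $p$. For a set $S$ of Laurent polynomials, $[n,S]=\{[n,p]:p\in S\}$ and $[n,S]'=\{[n,p]':p\in S\}$. An expression $\mathbb{C} t^{i}+\dots+\mathbb{C} t^{j}$ denotes the span of $t^i,\dots,t^j$ (equal to $\{0\}$ if $j<i$), and $\mathbb{C}^\times t^i+\mathbb{C}t^{i+1}+\dots+\mathbb{C}t^j$ (with $j\ge i$) denotes the set of $\sum_{m=i}^j p_m t^m$ with $p_i\neq 0$. An empty union is empty. $\mathbb{A}^d$ is affine $d$-space and $\mathbb{G}_m=\mathbb{A}^1\setminus\{0\}$. Definitions of the subsets: For $n>0$: $E_n^{\mathrm{o}} := [n, \mathbb{C}^{\times} t^{-n}+\mathbb{C} t^{-n+1}+\dots + \mathbb{C} t^{n-1}]$ and $E_n^{\mathrm{h}} := [n, \mathbb{C} t^{-n+1}+\mathbb{C} t^{-n+2}+\dots + \mathbb{C} t^{n-1}]$. For $n\ge 0$: $O_n^{\mathrm{o}} := [n,\mathbb{C}^{\times} t^{-n}+\mathbb{C} t^{-n+1}+\dots + \mathbb{C} t^n]'$ and $O_n^{\mathrm{h}} := [n, \mathbb{C} t^{-n+1}+ \mathbb{C} t^{-n+2}+\dots + \mathbb{C} t^n]'$. For $n<0$: $E_n^{\mathrm{o}}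 := [-n-1, \mathbb{C}^{\times}t^n+\mathbb{C} t^{n+1}+\dots +\mathbb{C} t^{-n-1}]'$ and $$E_n^{\mathrm{h}} := \Big(\bigsqcup_{k=1}^{-2n-1}[-n-1-k,\ \mathbb{C}^{\times} t^n + \mathbb{C} t^{n+1}+\dots + \mathbb{C} t^{-n-1-k}]'\Big)\sqcup \{[n,0]\}.$$ For $n<0$: $O_n^{\mathrm{o}} := [-n-1, \mathbb{C}^{\times}t^n+\mathbb{C} t^{n+1}+\dots+\mathbb{C} t^{-n-2}]$ and $$O_n^{\mathrm{h}} := \Big(\bigsqcup_{k=1}^{-2n-2}[-n-1-k,\ \mathbb{C}^{\times}t^n +\mathbb{C} t^{n+1}+\dots + \mathbb{C} t^{-n-2-k}]\Big)\sqcup \{[n,0]'\}.$$ *)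

(* Defs.v *)
From HB Require Import structures.
From mathcomp Require Import all_boot all_order all_algebra.
From mathcomp Require Import boolp classical_sets functions fsbigop reals.
From mathcomp Require Import complex mpoly zify.
Set Implicit Arguments.
Unset Strict Implicit.
Unset Printing Implicit Defensive.
Import Order.TTheory GRing.Theory Num.Theory.
Local Open Scope classical_set_scope.
Local Open Scope ring_scope.

Record laurent (K : comNzRingType) := Laurent {
  lcoef :> int -> K;
  lcoef_bounded : exists N : int, forall k : int, k < N -> lcoef k = 0 }.

HB.instance Definition _ (K : comNzRingType) := gen_eqMixin (laurent K).
HB.instance Definition _ (K : comNzRingType) := gen_choiceMixin (laurent K).

Section LaurentRing.
Variable K : comNzRingType.
Implicit Types f g h : laurent K.

Lemma laurentP f g : (forall k, f k = g k) -> f = g.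
Proof.
case: f g => [f hf] [g hg] /= /funext E; case: _ / E in hg *.
by congr Laurent; exact: Prop_irrelevance.
Qed.

Fact lzero_subproof :
  exists N : int, forall k : int, k < N -> (fun=> 0 : K) k = 0.
Proof. by exists 0. Qed.
Definition lzero := Laurent lzero_subproof.

Fact ladd_subproof f g :
  exists N : int, forall k : int, k < N -> (fun i => f i + g i) k = 0.
Proof.
have [[M hM] [N hN]] := (lcoef_bounded f, lcoef_bounded g).
by exists (Num.min M N) => k; rewrite lt_min => /andP[/hM -> /hN ->]; rewrite addr0.
Qed.
Definition ladd f g := Laurent (ladd_subproof f g).

Fact lopp_subproof f :
  exists N : int, forall k : int, k < N -> (fun i => - f i) k = 0.
Proof. by have [M hM] := lcoef_bounded f; exists M => k /hM ->; rewrite oppr0. Qed.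
Definition lopp f := Laurent (lopp_subproof f).

Fact monom_subproof (c : K) (n : int) :
  exists N : int, forall k : int, k < N -> (fun i => if i == n then c else 0) k = 0.
Proof. by exists n => k /lt_eqF ->. Qed.
(* The Laurent monomial c t^n. *)
Definition monom (c : K) (n : int) := Laurent (monom_subproof c n).

(* Only finitely many terms of the convolution are nonzero, so the finitely
   supported sum below is the usual Cauchy product. *)
Fact lmul_subproof f g : exists N : int, forall k : int, k < N ->
  (fun n : int => \sum_(i \in [set: int]) f i * g (n - i)) k = 0.
Proof.
have [[M hM] [N hN]] := (lcoef_bounded f, lcoef_bounded g).
exists (M + N) => k hk; apply: fsbig1 => i _.
case: (ltP i M) => [/hM ->|hi]; first by rewrite mul0r.
by rewrite hN ?mulr0 //; lia.
Qed.
Definition lmul f g := Laurent (lmul_subproof f g).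

Fact laddA : associative ladd.
Proof. by move=> f g h; apply: laurentP => k /=; rewrite addrA. Qed.
Fact laddC : commutative ladd.
Proof. by move=> f g; apply: laurentP => k /=; rewrite addrC. Qed.
Fact ladd0 : left_id lzero ladd.
Proof. by move=> f; apply: laurentP => k /=; rewrite add0r. Qed.
Fact laddN : left_inverse lzero lopp ladd.
Proof. by move=> f; apply: laurentP => k /=; rewrite addNr. Qed.

HB.instance Definition _ :=
  GRing.isZmodule.Build (laurent K) laddA laddC ladd0 laddN.

(* The ring axioms are transferred from {poly K} by truncation. *)
Let vanish (N : nat) f := forall k : int, k < - N%:Z -> f k = 0.
Let trunc (N B : nat) f : {poly K} := \poly_(i < B) f (i%:Z - N%:Z).

Let vanish_ex f : exists N, vanish N f.
Proof.
have [M hM] := lcoef_bounded f.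
by exists `|M|%N => k hk; apply: hM; lia.
Qed.

Let vanishW N M f : (N <= M)%N -> vanish N f -> vanish M f.
Proof. by move=> NM hf k hk; apply: hf; lia. Qed.

Let lmul_trunc N M B f g (m : nat) : vanish N f -> vanish M g -> (m < B)%N ->
  lmul f g (m%:Z - (N + M)%N%:Z) = (trunc N B f * trunc M B g)`_m.
Proof.
move=> hf hg mB; rewrite coefM /=.
pose r := [seq i%:Z - N%:Z | i <- iota 0 m.+1].
have ur : uniq r by rewrite map_inj_uniq ?iota_uniq// => i j; lia.
rewrite (fsbigE r) //; last first.
  move=> i _ ir; case: (ltP i (- N%:Z)) => [/hf ->|hi]; first by rewrite mul0r.
  rewrite (hg (_ - _)) ?mulr0 //.
  case: (ltP (m%:Z - (N + M)%N%:Z - i) (- M%:Z)) => // hi'.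
  exfalso; move/negP: ir; apply.
  apply/mapP; exists (absz (i + N%:Z)%R); last by lia.
  by rewrite mem_iota; lia.
rewrite big_map -[m.+1]subn0 -/(index_iota _ _) big_mkcond/= big_mkord.
apply: eq_bigr => i _; rewrite in_setT !coef_poly.
have := ltn_ord i => him.
have -> : (i < B)%N by lia.
have -> : (m - i < B)%N by lia.
by move: (nat_of_ord i) him => {}i him; congr (_ * g _); lia.
Qed.

Let vanish_mul N M f g : vanish N f -> vanish M g -> vanish (N + M) (lmul f g).
Proof.
move=> hf hg k hk; apply: fsbig1 => i _.
case: (ltP i (- N%:Z)) => [/hf ->|hi]; first by rewrite mul0r.
by rewrite hg ?mulr0 //; lia.
Qed.

Let coef_mul_eq (p p' q q' : {poly K}) m :
  (forall i, (i <= m)%N -> p`_i = p'`_i) -> (forall i, (i <= m)%N -> q`_i = q'`_i) ->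
  (p * q)`_m = (p' * q')`_m.
Proof.
move=> hp hq; rewrite !coefM; apply: eq_bigr => i _.
by rewrite hp ?hq ?leq_subr// -ltnS.
Qed.

Let truncM N M B f g i : vanish N f -> vanish M g -> (i < B)%N ->
  (trunc (N + M) B (lmul f g))`_i = (trunc N B f * trunc M B g)`_i.
Proof. by move=> hf hg iB; rewrite coef_poly iB (lmul_trunc hf hg iB). Qed.

Let lcoef_eq N f g : vanish N f -> vanish N g ->
  (forall m : nat, f (m%:Z - N%:Z) = g (m%:Z - N%:Z)) -> f = g.
Proof.
move=> hf hg E; apply: laurentP => k.
case: (ltP k (- N%:Z)) => [hk|hk]; first by rewrite hf ?hg.
by have := E (absz (k + N%:Z)%R); congr (f _ = g _); lia.
Qed.

Fact lmulC : commutative lmul.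
Proof.
move=> f g; have [[N hN] [M hM]] := (vanish_ex f, vanish_ex g).
apply: (@lcoef_eq (N + M)); [exact: (vanish_mul hN hM)|by rewrite addnC; exact: (vanish_mul hM hN)|].
move=> m; rewrite (lmul_trunc hN hM (ltnSn m)) addnC.
by rewrite (lmul_trunc hM hN (ltnSn m)) mulrC.
Qed.

Fact lmulA : associative lmul.
Proof.
move=> f g h.
have [[[N hN] [M hM]] [L hL]] := (vanish_ex f, vanish_ex g, vanish_ex h).
have hgh := vanish_mul hM hL; have hfg := vanish_mul hN hM.
apply: (@lcoef_eq (N + (M + L))); first exact: (vanish_mul hN hgh).
  by rewrite addnA; exact: (vanish_mul hfg hL).
move=> m; rewrite (lmul_trunc hN hgh (ltnSn m)) addnA.
rewrite (lmul_trunc hfg hL (ltnSn m)).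
rewrite (@coef_mul_eq _ (trunc N m.+1 f) _ (trunc M m.+1 g * trunc L m.+1 h)) //;
  last by move=> i im; exact: truncM.
rewrite mulrA; apply: coef_mul_eq => // i im.
by rewrite -truncM.
Qed.

Fact lmul1 : left_id (monom 1 0) lmul.
Proof.
move=> f; have [N hN] := vanish_ex f.
have h1 : vanish 0 (monom 1 0) by move=> k /=; rewrite oppr0 => /lt_eqF ->.
apply: (@lcoef_eq N) => //; first exact: (vanish_mul h1 hN).
move=> m; have := lmul_trunc h1 hN (ltnSn m); rewrite add0n => ->.
rewrite (_ : trunc 0 _ _ = 1) ?mul1r ?coef_poly ?ltnSn //.
apply/polyP => i; rewrite coef_poly coef1 /= subr0.
by case: i => [|i] //=; case: ifP.
Qed.

Fact lmulDl : left_distributive lmul +%R.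
Proof.
move=> f g h.
have [[[N0 hN0] [M0 hM0]] [L hL]] := (vanish_ex f, vanish_ex g, vanish_ex h).
pose N := maxn N0 M0.
have hN : vanish N f by apply: vanishW hN0; exact: leq_maxl.
have hM : vanish N g by apply: vanishW hM0; exact: leq_maxr.
have hD : vanish N (f + g) by move=> k hk /=; rewrite hN ?hM ?addr0.
apply: (@lcoef_eq (N + L)); first exact: (vanish_mul hD hL).
  move=> k hk; rewrite -[LHS]/(lmul f h k + lmul g h k).
  by rewrite (vanish_mul hN hL hk) (vanish_mul hM hL hk) addr0.
move=> m; rewrite (lmul_trunc hD hL (ltnSn m)).
rewrite -[RHS]/(lmul f h _ + lmul g h _).
rewrite (lmul_trunc hN hL (ltnSn m)) (lmul_trunc hM hL (ltnSn m)).
rewrite -coefD -mulrDl; congr (nth 0 (polyseq (_ * _)) m).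
by apply/polyP => i; rewrite coefD !coef_poly; case: ifP => _ //; rewrite addr0.
Qed.

Fact lone_neq0 : monom 1 0 != 0.
Proof.
by apply/eqP => /(congr1 (fun f : laurent K => f 0))/eqP; rewrite /= oner_eq0.
Qed.

HB.instance Definition _ :=
  GRing.Zmodule_isComNzRing.Build (laurent K) lmulA lmulC lmul1 lmulDl lone_neq0.

End LaurentRing.

(* f lies in K[[t]] *)
Definition is_pseries (K : comNzRingType) (f : laurent K) :=
  forall k : int, k < 0 -> f k = 0.

Definition mx2 (K : comNzRingType) (a b c d : K) : 'M[K]_2 :=
  \matrix_(i < 2, j < 2) if i == 0 then (if j == 0 then a else b)
                         else (if j == 0 then c else d).

Section Flag.
Variable K : fieldType.
Local Notation L := (laurent K).
Local Notation t_ n := (monom (1 : K) n).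

Definition SL2 : set 'M[L]_2 := [set g | \det g = 1].

Definition Iwahori : set 'M[L]_2 :=
  [set g | exists a b c d : L,
     [/\ is_pseries a, is_pseries b, is_pseries c & is_pseries d] /\
     a * d - t_ 1 * b * c = 1 /\ g = mx2 a b (t_ 1 * c) d].

Definition I3 : set 'M[L]_2 :=
  [set g | exists a b c d : L,
     [/\ is_pseries a, is_pseries b, is_pseries c & is_pseries d] /\
     a * d - t_ 4 * b * c = 1 /\ g = mx2 a (t_ 2 * b) (t_ 2 * c) d].

Definition I4 : set 'M[L]_2 :=
  [set g | exists (alpha : K) (a b c d : L),
     [/\ is_pseries a, is_pseries b, is_pseries c & is_pseries d] /\
     alpha != 0 /\ a + d + t_ 2 * (a * d - b * c) = 0 /\
     g = mx2 (monom alpha 0 * (1 + t_ 2 * a)) (t_ 2 * b)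
             (t_ 2 * c) (monom alpha^-1 0 * (1 + t_ 2 * d))].

(* The points of SL_2((t))/I are the left cosets gI, as subsets of SL_2((t)). *)
Definition cosetI (g : 'M[L]_2) : set 'M[L]_2 := [set g *m h | h in Iwahori].

Definition flag : set (set 'M[L]_2) := [set cosetI g | g in SL2].

Definition act (h : 'M[L]_2) (x : set 'M[L]_2) : set 'M[L]_2 :=
  [set h *m g | g in x].

Definition orbit_of (H : set 'M[L]_2) (x : set 'M[L]_2) : set (set 'M[L]_2) :=
  [set act h x | h in H].

Definition is_orbit (H : set 'M[L]_2) (Y : set (set 'M[L]_2)) :=
  exists2 x, flag x & Y = orbit_of H x.

(* [n, p] and [n, p]'; the degree conditions on p hold for all the sets of
   polynomials used below. *)
Definition pt (n : int) (p : L) := cosetI (mx2 (t_ n) p 0 (t_ (- n))).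
Definition pt' (n : int) (p : L) := cosetI (mx2 p (t_ n) (- t_ (- n)) 0).

(* C t^i + ... + C t^j *)
Definition span_t (i j : int) : set L :=
  [set p | forall k : int, ~~ (i <= k <= j) -> p k = 0].
(* C^* t^i + C t^(i+1) + ... + C t^j *)
Definition span_t_unit (i j : int) : set L :=
  [set p | span_t i j p /\ p i != 0].

Definition pts (n : int) (S : set L) := pt n @` S.
Definition pts' (n : int) (S : set L) := pt' n @` S.

(* Eo and Eh are only meaningful for n <> 0. *)
Definition Eo (n : int) : set (set 'M[L]_2) :=
  if 0 < n then pts n (span_t_unit (- n) (n - 1))
  else pts' (- n - 1) (span_t_unit n (- n - 1)).

Definition Eh (n : int) : set (set 'M[L]_2) :=
  if 0 < n then pts n (span_t (- n + 1) (n - 1))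
  else (\bigcup_(k in [set k : int | 1 <= k <= - 2 * n - 1])
          pts' (- n - 1 - k) (span_t_unit n (- n - 1 - k)))
       `|` [set pt n 0].

Definition Oo (n : int) : set (set 'M[L]_2) :=
  if 0 <= n then pts' n (span_t_unit (- n) n)
  else pts (- n - 1) (span_t_unit n (- n - 2)).

Definition Oh (n : int) : set (set 'M[L]_2) :=
  if 0 <= n then pts' n (span_t (- n + 1) n)
  else (\bigcup_(k in [set k : int | 1 <= k <= - 2 * n - 2])
          pts (- n - 1 - k) (span_t_unit n (- n - 2 - k)))
       `|` [set pt' n 0].

Definition Eho (n : int) := pts n (span_t_unit (- n + 1) (n - 1)).
Definition Ehh (n : int) := pts n (span_t (- n + 2) (n - 1)).
Definition Oho (n : int) := pts' n (span_t_unit (- n + 1) n).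
Definition Ohh (n : int) := pts' n (span_t (- n + 2) n).

Definition zariski_closed m (Z : set 'rV[K]_m) :=
  exists S : set {mpoly K[m]}, Z = [set x | forall p, S p -> p.@[x 0] = 0].

(* locally closed subsets of affine space, with their reduced structure *)
Definition quasi_affine m (T : set 'rV[K]_m) :=
  exists Z Z', [/\ zariski_closed Z, zariski_closed Z' & T = Z `\` Z'].

Definition principal_open m (q : {mpoly K[m]}) : set 'rV[K]_m :=
  [set x | q.@[x 0] != 0].

Definition regular_fun m (T : set 'rV[K]_m) (f : 'rV[K]_m -> K) :=
  forall x, T x -> exists p q : {mpoly K[m]}, principal_open q x /\
    forall y, T y -> principal_open q y -> f y = p.@[y 0] / q.@[y 0].

Definition regular_map m k (T : set 'rV[K]_m) (X : set 'rV[K]_k)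
    (f : 'rV[K]_m -> 'rV[K]_k) :=
  f @` T `<=` X /\ forall i, regular_fun T (fun x => f x 0 i).

(* The varieties T are quasi-affine sets of K-points, K algebraically closed.
   Morphisms from T to the ind-variety SL_2((t)): the entries have uniformly
   bounded poles and their coefficients are regular functions. *)
Definition SL2_morphism m (T : set 'rV[K]_m) (g : 'rV[K]_m -> 'M[L]_2) :=
  [/\ g @` T `<=` SL2,
      exists N : int, forall x i j (k : int), T x -> k < N -> g x i j k = 0
    & forall i j (k : int), regular_fun T (fun x => g x i j k)].

(* Morphisms from T to the quotient SL_2((t))/I: maps which Zariski-locally
   lift to SL_2((t)). This is the ind-variety structure of SL_2((t))/I because
   SL_2((t)) -> SL_2((t))/I is a Zariski-locally trivial I-torsor. *)
Definition flag_morphism m (T : set 'rV[K]_m)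
    (psi : 'rV[K]_m -> set 'M[L]_2) :=
  forall x, T x -> exists (q : {mpoly K[m]}) (g : 'rV[K]_m -> 'M[L]_2),
    [/\ principal_open q x, SL2_morphism (T `&` principal_open q) g
      & forall y, T y -> principal_open q y -> psi y = cosetI (g y)].

(* Y, as a reduced subvariety of SL_2((t))/I, is isomorphic to X: there is a
   bijective morphism phi : X -> Y through which every morphism from a variety
   to SL_2((t))/I with values in Y factors. *)
Definition isomorphic_to m (Y : set (set 'M[L]_2)) (X : set 'rV[K]_m) :=
  exists phi : 'rV[K]_m -> set 'M[L]_2,
    [/\ set_bij X Y phi, flag_morphism X phi
      & forall k (T : set 'rV[K]_k) psi,
          quasi_affine T -> flag_morphism T psi -> psi @` T `<=` Y ->
          exists2 f : 'rV[K]_k -> 'rV[K]_m, regular_map T X f &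
            forall x, T x -> psi x = phi (f x)].

Definition affine_space d : set 'rV[K]_d := [set: 'rV[K]_d].
Definition Gm : set 'rV[K]_1 := [set x | x 0 0 != 0].
Definition prod_var m k (X : set 'rV[K]_m) (Y : set 'rV[K]_k) :
  set 'rV[K]_(m + k) := [set x | X (lsubmx x) /\ Y (rsubmx x)].

End Flag.

Arguments I3 {K}.
Arguments I4 {K}.
Arguments Gm {K}.
Arguments affine_space {K} d.
Arguments Eo K n : clear implicits.
Arguments Eh K n : clear implicits.
Arguments Oo K n : clear implicits.
Arguments Oh K n : clear implicits.
Arguments Eho K n : clear implicits.
Arguments Ehh K n : clear implicits.
Arguments Oho K n : clear implicits.
Arguments Ohh K n : clear implicits.

(* Main.v *)
Require Import Defs.
From HB Require Import structures.
From mathcomp Require Import all_boot all_order all_algebra.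
From mathcomp Require Import boolp classical_sets functions fsbigop reals complex.
From mathcomp Require Import mpoly zify ring.
Set Implicit Arguments.
Unset Strict Implicit.
Unset Printing Implicit Defensive.
Import Order.TTheory GRing.Theory Num.Theory.
Local Open Scope classical_set_scope.
Local Open Scope ring_scope.

(** Over a ground field K, the points of SL_2((t))/I are balls in K((t)). The
    group SL_2((t)) acts on the projective line over K((t)) by Moebius
    transformations, and I is the stabilizer of the ball K[[t]]. The coset [n,
    p] consists of the matrices that send K[[t]] to the ball t^n p + t^(2n)
    K[[t]], and [n, p]' of those that send it to the complement of the ball -
    t^n p + t^(2n+1) K[[t]] ([pt_ball], [pt'_ball]). The radius tells the two
    families apart, and the center carries the polynomial p, so strata become
    sets of balls described by the valuation of the center.

    For n > 0 (n >= 0 for the O family) the strata are the sets of balls of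
    radius 2n or 2n+1 whose center x has valuation 0 (o), at least 1 (h), exactly
    1 (ho) or at least 2 (hh).  A matrix of I_3 has invertible diagonal
    entries and off-diagonal entries divisible by t^2, so x |-> (a x + b)/(c x + d)
    preserves these conditions ([act_I3], [stab_val]).  Conversely, translations
    by b in t^2 K[[t]] correct all coefficients from t^2 on, so transitivity only
    concerns the coefficients of 1 and t.  On valuation 1 and on valuation at
    least 2 a constant diagonal matrix adjusts them, which even lies in I_4
    ([I4_move]); on valuation 0 the diagonal entry needs a t-term as well, which
    is why I_3 is required there ([I3_move_unit]).

    For n < 0 the strata look irregular because they are seen from the wrong end
    of the projective line.  The Weyl element x |-> -1/x normalizes I_3 and turns
    the balls with center of valuation s into balls with center of valuation -s
    and radius decreased by 2s.  It carries the balls with center of valuation 1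
    onto E_n^o and O_n^o, and those with center of valuation at least 2 onto
    E_n^h and O_n^h: one piece of the union for each s, the isolated point being
    the image of the ball around 0 ([weyl_val], [weyl_val2]).

    For the isomorphisms, the coefficients of the center below the radius are
    the coordinates.  Given a lift of a morphism T -> SL_2((t))/I with values in
    such a stratum, the center x is the quotient of the two entries of one column
    up to the radius, and the bottom entry of this column has a constant
    valuation ([ball_pivot]).  Its leading coefficient is an invertible regular
    function, so long division shows by induction that every coefficient of x is
    regular ([iso_ball]). *)

(** * Valuation and inversion of Laurent series *)

Section LaurentSeries.
Variable K : fieldType.
Local Notation L := (laurent K).
Local Notation t_ n := (monom (1 : K) n).
Implicit Types f g x y : L.

Definition val_ge (m : int) : set L := [set f | forall k : int, k < m -> f k = 0].
Definition val_eq (m : int) : set L := [set f | val_ge m f /\ f m != 0].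

Lemma lcoefD f g k : (f + g) k = f k + g k. Proof. by []. Qed.
Lemma lcoefN f k : (- f) k = - f k. Proof. by []. Qed.
Lemma lcoefB f g k : (f - g) k = f k - g k. Proof. by []. Qed.
Lemma lcoef1 k : (1 : L) k = (k == 0)%:R.
Proof. by rewrite [LHS]/= ; case: eqP. Qed.
Lemma lcoef_sum (I : Type) (r : seq I) (F : I -> L) k :
  (\sum_(i <- r) F i) k = \sum_(i <- r) F i k.
Proof. by elim/big_rec2: _ => [|i a b _ <-]. Qed.

Lemma lcoef_monomM c m f k : (monom c m * f) k = c * f (k - m).
Proof.
rewrite -[LHS]/(\sum_(i \in [set: int]) monom c m i * f (k - i)).
rewrite (fsbigE [:: m]) //=; last first.
  by move=> i _; rewrite inE => /negbTE ->; rewrite mul0r.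
by rewrite big_mkcond /= big_cons big_nil in_setT eqxx addr0.
Qed.

Lemma monomM c d m n : monom c m * monom d n = monom (c * d) (m + n) :> L.
Proof.
apply: laurentP => k; rewrite lcoef_monomM /=.
have -> : (k - m == n) = (k == m + n) by apply/eqP/eqP; lia.
by case: eqP; rewrite // mulr0.
Qed.

Lemma tM m n : t_ m * t_ n = t_ (m + n). Proof. by rewrite monomM mulr1. Qed.
Lemma tVM n : t_ n * t_ (- n) = 1. Proof. by rewrite tM subrr. Qed.

Lemma tK n x : t_ n * (t_ (- n) * x) = x.
Proof. by rewrite mulrA tVM mul1r. Qed.

(** With both factors bounded below, the convolution is an explicit finite sum;
    this is the form in which coefficients of products are divided out later. *)
Lemma lcoefM_val_ge m n f g (k : nat) : val_ge m f -> val_ge n g ->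
  (f * g) (m + n + k%:Z) = \sum_(i < k.+1) f (m + i%:Z) * g (n + k%:Z - i%:Z).
Proof.
move=> hf hg.
rewrite -[LHS]/(\sum_(i \in [set: int]) f i * g (m + n + k%:Z - i)).
pose r : seq int := [seq (m + i%:Z : int) | i <- iota 0 k.+1].
have ur : uniq r by rewrite map_inj_uniq ?iota_uniq// => i j; lia.
rewrite (fsbigE r) //; last first.
  move=> i _ ir; case: (ltP i m) => [/hf ->|hi]; first by rewrite mul0r.
  rewrite (hg (_ - _)) ?mulr0 //.
  case: (ltP (m + n + k%:Z - i) n) => // hi'.
  exfalso; move/negP: ir; apply.
  apply/mapP; exists (absz (i - m)%R); last by lia.
  by rewrite mem_iota; lia.
rewrite big_map -[k.+1]subn0 -/(index_iota _ _) big_mkcond/= big_mkord.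
by apply: eq_bigr => i _; rewrite in_setT; congr (_ * g _) => /=;
  move: (nat_of_ord i) => {}i; lia.
Qed.

Lemma val_geW m n f : m <= n -> val_ge n f -> val_ge m f.
Proof. by move=> mn hf k km; apply: hf; lia. Qed.

Lemma val_ge_coef m f k : val_ge m f -> k < m -> f k = 0.
Proof. exact. Qed.

Lemma val_geD m f g : val_ge m f -> val_ge m g -> val_ge m (f + g).
Proof. by move=> hf hg k km; rewrite lcoefD hf ?hg ?addr0. Qed.
Lemma val_geN m f : val_ge m f -> val_ge m (- f).
Proof. by move=> hf k km; rewrite lcoefN hf ?oppr0. Qed.
Lemma val_geB m f g : val_ge m f -> val_ge m g -> val_ge m (f - g).
Proof. by move=> hf /val_geN; exact: val_geD. Qed.
Lemma val_ge_monom m c n : m <= n -> val_ge m (monom c n).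
Proof. by move=> mn k km /=; case: eqP => // kn; lia. Qed.

Lemma val_geM m n l f g : val_ge m f -> val_ge n g -> l <= m + n -> val_ge l (f * g).
Proof.
move=> hf hg lmn k kl; apply: fsbig1 => i _.
case: (ltP i m) => [/hf ->|hi]; first by rewrite mul0r.
by rewrite hg ?mulr0 //; lia.
Qed.

Lemma val_ge_tM m n f : val_ge m (t_ n * f) <-> val_ge (m - n) f.
Proof.
split=> hf k km.
  by have := hf (k + n); rewrite lcoef_monomM mul1r addrK; apply; lia.
by rewrite lcoef_monomM mul1r hf //; lia.
Qed.

Lemma val_ge_tME m n x : val_ge m (t_ n * x) = val_ge (m - n) x.
Proof. by apply: propext; exact: val_ge_tM. Qed.

Lemma val_geNE m x : val_ge m (- x) = val_ge m x.
Proof. by apply: propext; split=> /val_geN //; rewrite opprK. Qed.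

Lemma lcoefM_lead m n f g : val_ge m f -> val_ge n g -> (f * g) (m + n) = f m * g n.
Proof.
move=> hf hg; have := lcoefM_val_ge 0 hf hg; rewrite addr0 => ->.
by rewrite big_ord1; congr (f _ * g _) => /=; lia.
Qed.

Lemma val_eqM m n f g : val_eq m f -> val_eq n g -> val_eq (m + n) (f * g).
Proof.
move=> [hf f0] [hg g0]; split; first exact: val_geM hf hg _.
by rewrite lcoefM_lead // mulf_neq0.
Qed.

Lemma val_eq_monom c n : c != 0 -> val_eq n (monom c n).
Proof. by move=> c0; split; [exact: val_ge_monom|rewrite /= eqxx]. Qed.

Lemma val_eqN n f : val_eq n f -> val_eq n (- f).
Proof. by move=> [hf f0]; split; [exact: val_geN|rewrite lcoefN oppr_eq0]. Qed.

Lemma val_eqDr n f g : val_eq n f -> val_ge (n + 1) g -> val_eq n (f + g).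
Proof.
move=> [hf f0] hg; split; last by rewrite lcoefD (hg n) ?addr0 //; lia.
by apply: val_geD => //; apply: val_geW hg; lia.
Qed.

Lemma val_eq_congr m n f g : val_eq m f -> val_ge n (f - g) -> m < n -> val_eq m g.
Proof.
move=> hf hfg mn; rewrite -[g](subKr f); apply: val_eqDr => //.
by apply: val_geN; apply: val_geW hfg; lia.
Qed.

Lemma val_geX w i : val_ge 1 w -> val_ge i%:Z (w ^+ i).
Proof.
move=> hw; elim: i => [|i IH]; first exact: val_ge_monom.
by rewrite exprS; apply: val_geM hw IH _; lia.
Qed.

(** The geometric series of w: the coefficient of t^k in w^i vanishes for i > k,
    so each coefficient of the sum of the powers of w is a finite sum. *)
Lemma geometric_ex w : val_ge 1 w -> exists2 g, val_ge 0 g & (1 - w) * g = 1.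
Proof.
move=> hw.
pose c (k : int) := if k < 0 then 0 else \sum_(i < `|k|.+1) (w ^+ i) k.
have cb : exists N : int, forall k : int, k < N -> c k = 0.
  by exists 0 => k k0; rewrite /c k0.
pose g := Laurent cb.
have g0 : val_ge 0 g by move=> k k0; rewrite /= /c k0.
exists g => //; apply: laurentP => k.
have gk : val_ge (k + 1) (g - \sum_(i < `|k|.+1) w ^+ i).
  move=> j jk; rewrite lcoefB lcoef_sum.
  case: (ltP j 0) => j0.
    rewrite g0 // big1 ?subr0 // => i _; apply: (val_geX hw); lia.
  rewrite /= /c ltNge j0 /=.
  have le_jk : (`|j|.+1 <= `|k|.+1)%N by lia.
  rewrite (big_ord_widen _ (fun i => (w ^+ i) j) le_jk) big_mkcond -sumrB /=.
  apply: big1 => i _; case: ifP => hi; first by rewrite subrr.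
  by rewrite sub0r (val_geX hw) ?oppr0 //; lia.
have w1 : val_ge 0 (1 - w).
  by apply: val_geB; [exact: val_ge_monom|apply: val_geW hw].
case: (ltP k 0) => k0.
  by rewrite (val_ge_coef (val_geM w1 g0 (l := 0) _)) // lcoef1; case: eqP => //; lia.
(* The telescoping identity for a partial sum, which differs from g only
   beyond t^k. *)
have -> : (1 - w) * g = 1 - w ^+ `|k|.+1
    + (1 - w) * (g - \sum_(i < `|k|.+1) w ^+ i).
  by rewrite mulrBr -[_ * \sum_(i < _) _]opprK -mulNr opprB -subrX1; ring.
rewrite lcoefD lcoefB (val_geX hw) ?subr0; last by lia.
by rewrite (val_ge_coef (val_geM w1 gk (l := k + 1) _)) ?addr0 //; lia.
Qed.

(** Dividing by the leading monomial reduces this to the geometric series. *)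
Lemma val_eqV n f : val_eq n f -> exists2 g, val_eq (- n) g & f * g = 1.
Proof.
move=> [hf f0]; pose w : L := 1 - monom (f n)^-1 (- n) * f.
have hw : val_ge 1 w.
  move=> k k1; rewrite /w lcoefB lcoef_monomM lcoef1 opprK.
  case: eqP => [->|k0]; first by rewrite add0r mulVf // subrr.
  by rewrite (hf (k + n)) ?mulr0 ?subrr //; lia.
have [g hg] := geometric_ex hw; rewrite /w subKr => gE.
have fg : f * (monom (f n)^-1 (- n) * g) = 1 by rewrite -gE; ring.
exists (monom (f n)^-1 (- n) * g) => //.
have hg' : val_ge (- n) (monom (f n)^-1 (- n) * g).
  by apply: val_geM (val_ge_monom _ _) hg _ => //; rewrite addr0.
split=> //; apply/eqP => g0; have := lcoefM_lead hf hg'.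
by rewrite fg g0 subrr mulr0 lcoef1 eqxx => /eqP; rewrite oner_eq0.
Qed.

Lemma val_ge_eq m n f : val_ge m f -> val_ge n f \/ exists2 s, m <= s < n & val_eq s f.
Proof.
move=> hf; have [fn|/existsNP[k /not_implyP[kn fk]]] := pselect (val_ge n f).
  by left.
right; have ex : exists i, f (m + i%:Z) != 0.
  exists `|k - m|%N; apply/eqP => fk0; apply: fk.
  case: (ltP k m) => [/hf //|mk]; rewrite -fk0; congr (f _); lia.
have [i fi mini] := ex_minnP ex.
have fge : val_ge (m + i%:Z) f.
  move=> j jm; case: (ltP j m) => [/hf //|mj].
  apply/eqP/negPn/negP => fj; have := mini `|j - m|%N.
  by rewrite (_ : m + _ = j) ?fj => [/(_ isT)|]; lia.
exists (m + i%:Z); last by [].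
suff : m + i%:Z < n by lia.
rewrite ltNge; apply/negP => nm; apply: fk; apply: fge; lia.
Qed.

End LaurentSeries.

(** * Matrices of size 2 *)

Section Matrices.
Variable R : comNzRingType.
Implicit Types a b c d : R.

Lemma mx2E a b c d : [/\ mx2 a b c d 0 0 = a, mx2 a b c d 0 1 = b,
  mx2 a b c d 1 0 = c & mx2 a b c d 1 1 = d].
Proof. by split; rewrite mxE. Qed.

Lemma mx2_eta (g : 'M[R]_2) : g = mx2 (g 0 0) (g 0 1) (g 1 0) (g 1 1).
Proof.
apply/matrixP => i j; rewrite mxE.
by case: i j => [[|[|//]] hi] [[|[|//]] hj] /=;
  congr (g _ _); apply/val_inj.
Qed.

(** Lets one introduce a matrix directly as [mx2 a b c d]. *)
Lemma mx2P (P : 'M[R]_2 -> Prop) :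
  (forall a b c d, P (mx2 a b c d)) -> forall g, P g.
Proof. by move=> h g; rewrite (mx2_eta g). Qed.

Lemma mx2_inj a b c d a' b' c' d' : mx2 a b c d = mx2 a' b' c' d' ->
  [/\ a = a', b = b', c = c' & d = d'].
Proof.
move=> E; have := mx2E a b c d; rewrite E.
by have [-> -> -> ->] := mx2E a' b' c' d'; case.
Qed.

Lemma mulmx_mx2 a b c d a' b' c' d' : mx2 a b c d *m mx2 a' b' c' d' =
  mx2 (a * a' + b * c') (a * b' + b * d') (c * a' + d * c') (c * b' + d * d').
Proof.
apply/matrixP => i j; rewrite !mxE !big_ord_recl big_ord0 /= !mxE /= addr0.
by case: ifP => _; case: ifP.
Qed.

Lemma det_mx2 a b c d : \det (mx2 a b c d) = a * d - b * c.
Proof.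
rewrite (expand_det_row _ 0) !big_ord_recl big_ord0 /cofactor !det_mx11 !mxE /=.
by rewrite expr0 expr1; ring.
Qed.

Lemma mx2_1 : mx2 1 0 0 1 = 1%:M :> 'M[R]_2.
Proof.
by apply/matrixP => i j; rewrite !mxE; case: i j => [[|[|//]] hi] [[|[|//]] hj].
Qed.

Lemma mx2_adjK a b c d (g : 'M[R]_2) : a * d - b * c = 1 ->
  mx2 a b c d *m (mx2 d (- b) (- c) a *m g) = g.
Proof.
move=> E; rewrite mulmxA mulmx_mx2 -[RHS]mul1mx -mx2_1; congr (mx2 _ _ _ _ *m _);
  by rewrite -?E; ring.
Qed.

Lemma mx2_adjVK a b c d (g : 'M[R]_2) : a * d - b * c = 1 ->
  mx2 d (- b) (- c) a *m (mx2 a b c d *m g) = g.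
Proof.
move=> E; have E' : d * a - - b * - c = 1 by rewrite -E; ring.
by have := mx2_adjK g E'; rewrite !opprK.
Qed.

End Matrices.

(** * Points of the affine flag variety as balls *)

Section Flags.
Variable K : fieldType.
Local Notation L := (laurent K).
Local Notation t_ n := (monom (1 : K) n).
Implicit Types (x y : L) (e c : int).

Lemma Iwahori_mx2 (a b c d : L) : Iwahori (mx2 a b c d) <->
  [/\ a * d - b * c = 1, val_ge 0 a, val_ge 0 b, val_ge 1 c & val_ge 0 d].
Proof.
split.
  move=> [a' [b' [c' [d' [[ha hb hc hd] [E /mx2_inj[-> -> -> ->]]]]]]]; split=> //.
    by rewrite -E; ring.
  by apply/val_ge_tM; rewrite subrr.
move=> [E ha hb hc hd]; exists a, b, (t_ (- 1) * c), d; split.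
  by split=> //; apply/val_ge_tM.
rewrite tK; split=> //.
by rewrite -E -[in RHS](tK 1 c); ring.
Qed.

Lemma t4 : t_ 4 = t_ 2 * t_ 2 :> L. Proof. by rewrite tM. Qed.

Lemma I3_mx2 (a b c d : L) : I3 (mx2 a b c d) <->
  [/\ a * d - b * c = 1, val_ge 0 a, val_ge 2 b, val_ge 2 c & val_ge 0 d].
Proof.
split.
  move=> [a' [b' [c' [d' [[ha hb hc hd] [E /mx2_inj[-> -> -> ->]]]]]]]; split=> //.
  - by rewrite -E t4; ring.
  - by apply/val_ge_tM; rewrite subrr.
  - by apply/val_ge_tM; rewrite subrr.
move=> [E ha hb hc hd]; exists a, (t_ (- 2) * b), (t_ (- 2) * c), d; split.
  by split=> //; apply/val_ge_tM.
rewrite !tK; split=> //.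
by rewrite -E t4 -[in RHS](tK 2 b) -[in RHS](tK 2 c); ring.
Qed.

Lemma cosetI_mx2 (p q r s A B C D : L) : p * s - q * r = 1 ->
  cosetI (mx2 p q r s) (mx2 A B C D) <->
  Iwahori (mx2 (s * A - q * C) (s * B - q * D) (p * C - r * A) (p * D - r * B)).
Proof.
move=> E; have -> : mx2 (s * A - q * C) (s * B - q * D) (p * C - r * A)
    (p * D - r * B) = mx2 s (- q) (- r) p *m mx2 A B C D.
  by rewrite mulmx_mx2; congr mx2; ring.
split=> [[h hI <-]|hI]; first by rewrite mx2_adjVK.
by exists (mx2 s (- q) (- r) p *m mx2 A B C D) => //; rewrite mx2_adjK.
Qed.

Lemma cosetI_refl (g : 'M[L]_2) : cosetI g g.
Proof.
exists 1%:M; last by rewrite mulmx1.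
rewrite -mx2_1.
apply/Iwahori_mx2; split; rewrite ?mulr1 ?mulr0 ?subr0 //; exact: val_ge_monom.
Qed.

(** For c = e this is the set of matrices in SL_2((t)) that map K[[t]] onto the
    ball x + t^(e+c) K[[t]]; for c = e + 1, onto the complement of that ball in
    the projective line.  Only these two cases give points of the flag variety;
    keeping e and c apart lets both parities of the radius e + c be treated at
    once.  The conditions say that, after subtracting x times the bottom row
    from the top row, the entries have the valuations of the corresponding
    translate of I. *)
Definition ball e c x : set 'M[L]_2 := [set g | [/\ \det g = 1,
  val_ge c (g 0 0 - x * g 1 0), val_ge e (g 0 1 - x * g 1 1),
  val_ge (1 - c) (g 1 0) & val_ge (- e) (g 1 1)]].

Lemma ball_mx2 e c x (A B C D : L) : ball e c x (mx2 A B C D) <->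
  [/\ A * D - B * C = 1, val_ge c (A - x * C), val_ge e (B - x * D),
      val_ge (1 - c) C & val_ge (- e) D].
Proof. by rewrite /ball /= det_mx2; have [-> -> -> ->] := mx2E A B C D. Qed.

Lemma set_mx2P (X Y : set 'M[L]_2) :
  (forall A B C D, X (mx2 A B C D) <-> Y (mx2 A B C D)) -> X = Y.
Proof. by move=> h; apply/seteqP; split=> g; rewrite (mx2_eta g) => /h. Qed.

(** Both lemmas multiply by the inverse of the representative and read off the
    conditions defining the Iwahori subgroup. *)
Lemma pt_ball n (p : L) : pt n p = ball n n (t_ n * p).
Proof.
have T := tVM K n; apply: set_mx2P => A B C D.
apply: (iff_trans (cosetI_mx2 _ _ _ _ _)); first by rewrite mulr0 subr0.
apply: (iff_trans (Iwahori_mx2 _ _ _ _)).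
apply: iff_trans (iff_sym (ball_mx2 _ _ _ _ _ _ _)).
rewrite !mul0r !subr0.
have -> : t_ (- n) * A - p * C = t_ (- n) * (A - t_ n * p * C).
  by rewrite -[p in LHS]mul1r -T; ring.
have -> : t_ (- n) * B - p * D = t_ (- n) * (B - t_ n * p * D).
  by rewrite -[p in LHS]mul1r -T; ring.
rewrite !val_ge_tME !sub0r !opprK.
have -> // : t_ (- n) * (A - t_ n * p * C) * (t_ n * D)
  - t_ (- n) * (B - t_ n * p * D) * (t_ n * C) = A * D - B * C.
by rewrite -[RHS]mul1r -T; ring.
Qed.

Lemma pt'_ball n (p : L) : pt' n p = ball n (n + 1) (- (t_ n * p)).
Proof.
have T := tVM K n; apply: set_mx2P => A B C D.
apply: (iff_trans (cosetI_mx2 _ _ _ _ _)); first by rewrite -T; ring.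
apply: (iff_trans (Iwahori_mx2 _ _ _ _)).
apply: iff_trans (iff_sym (ball_mx2 _ _ _ _ _ _ _)).
rewrite !mul0r !sub0r.
have -> : p * C - - t_ (- n) * A = t_ (- n) * (A - - (t_ n * p) * C).
  by rewrite -[p in LHS]mul1r -T; ring.
have -> : p * D - - t_ (- n) * B = t_ (- n) * (B - - (t_ n * p) * D).
  by rewrite -[p in LHS]mul1r -T; ring.
have -> : - (t_ n * C) * (t_ (- n) * (B - - (t_ n * p) * D))
  - - (t_ n * D) * (t_ (- n) * (A - - (t_ n * p) * C)) = A * D - B * C.
  by rewrite -[RHS]mul1r -T; ring.
rewrite !val_geNE !val_ge_tME !sub0r !opprK.
have -> : 1 - (n + 1) = - n by ring.
by rewrite [1 + n]addrC; split=> -[].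
Qed.

Lemma ball_pt e c x : c = e -> ball e c x = pt e (t_ (- e) * x).
Proof. by move=> ->; rewrite pt_ball mulrA tVM mul1r. Qed.

Lemma ball_pt' e c x : c = e + 1 -> ball e c x = pt' e (- (t_ (- e) * x)).
Proof. by move=> ->; rewrite pt'_ball mulrN opprK mulrA tVM mul1r. Qed.

Lemma flag_ball e c x : e <= c <= e + 1 -> flag (ball e c x).
Proof.
move=> ec; have [ce|ce] : c = e \/ c = e + 1 by lia.
  rewrite (ball_pt _ ce); eexists; last by [].
  by rewrite /SL2 /= det_mx2 tVM mulr0 subr0.
rewrite (ball_pt' _ ce); eexists; last by [].
by rewrite /SL2 /= det_mx2 mulr0 mulrN tVM sub0r opprK.
Qed.

(** Applied to the representative of the first ball, membership in the second
    one says that the two centers agree up to the radius. *)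
Lemma ball_eq e c x y : e <= c <= e + 1 ->
  ball e c x = ball e c y <-> val_ge (e + c) (x - y).
Proof.
move=> ec; split.
  have [ce|ce] : c = e \/ c = e + 1 by lia.
    rewrite (ball_pt x ce) => E.
    have : ball e c y (mx2 (t_ e) (t_ (- e) * x) 0 (t_ (- e))).
      by rewrite -E; exact: cosetI_refl.
    move=> /ball_mx2[_ _ h _ _]; apply: (val_geW (n := e - - e)); first by lia.
    by apply/val_ge_tM; rewrite mulrBr [t_ (-e) * y]mulrC.
  rewrite (ball_pt' x ce) => E.
  have : ball e c y (mx2 (- (t_ (- e) * x)) (t_ e) (- t_ (- e)) 0).
    by rewrite -E; exact: cosetI_refl.
  move=> /ball_mx2[_ h _ _ _]; apply: (val_geW (n := c - - e)); first by lia.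
  apply/val_ge_tM; have -> : t_ (- e) * (x - y) = - (- (t_ (- e) * x) - y * - t_ (- e)).
    by ring.
  exact: val_geN.
wlog suff : x y / val_ge (e + c) (x - y) -> ball e c x `<=` ball e c y.
  move=> H h; apply/seteqP; split; apply: H => //.
  by rewrite -opprB; exact: val_geN.
move=> h; apply: mx2P => A B C D /ball_mx2[E h1 h2 h3 h4].
apply/ball_mx2; split=> //.
  have -> : A - y * C = (A - x * C) + (x - y) * C by ring.
  by apply: val_geD => //; apply: val_geM h h3 _; lia.
have -> : B - y * D = (B - x * D) + (x - y) * D by ring.
by apply: val_geD => //; apply: val_geM h h4 _; lia.
Qed.

(** A matrix of SL_2(K[[t]]) acts as a Moebius transformation on the center as
    soon as the denominator c x + d is a unit, with inverse u, and it keeps the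
    radius.  The bounds on e and k make the denominator a unit on the whole ball.
    One inclusion suffices, since the inverse matrix is of the same kind: its
    denominator at the new center is again a unit, namely u. *)
Lemma act_ball (a b c d x u : L) e k : 0 <= e -> 1 <= k ->
  a * d - b * c = 1 -> val_ge 0 a -> val_ge 0 b -> val_ge 0 c -> val_ge 0 d ->
  val_ge 0 x -> val_ge 0 u -> u * (d + c * x) = 1 ->
  act (mx2 a b c d) (ball e k x) = ball e k (u * (a * x + b)).
Proof.
move=> e0 k0.
have sub (a' b' c' d' x' u' : L) : a' * d' - b' * c' = 1 -> val_ge 0 a' ->
    val_ge 0 b' -> val_ge 0 c' -> val_ge 0 d' -> val_ge 0 x' -> val_ge 0 u' ->
    u' * (d' + c' * x') = 1 ->
    act (mx2 a' b' c' d') (ball e k x') `<=` ball e k (u' * (a' * x' + b')).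
  move=> {}E {}ha {}hb {}hc {}hd {}hx {}hu uE _ [g + <-].
  move: g; apply: mx2P => A B C D /ball_mx2[AD h1 h2 h3 h4].
  rewrite mulmx_mx2; apply/ball_mx2.
  have mob (A' C' : L) : a' * A' + b' * C' - u' * (a' * x' + b') * (c' * A' + d' * C')
      = u' * (A' - x' * C').
    rewrite -[u' in RHS]mul1r -E -[a' * A' + b' * C']mul1r -uE; ring.
  have bot (A' C' : L) : c' * A' + d' * C' = c' * (A' - x' * C') + (d' + c' * x') * C'.
    by ring.
  have hu' : val_ge 0 (d' + c' * x') by apply: val_geD => //; exact: val_geM hc hx _.
  rewrite !mob; split.
  - by rewrite -[RHS]mul1r -{1}E -AD; ring.
  - by apply: val_geM hu h1 _; rewrite add0r.
  - by apply: val_geM hu h2 _; rewrite add0r.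
  - by rewrite bot; apply: val_geD; [apply: val_geM hc h1 _|apply: val_geM hu' h3 _]; lia.
  - by rewrite bot; apply: val_geD; [apply: val_geM hc h2 _|apply: val_geM hu' h4 _]; lia.
move=> E ha hb hc hd hx hu uE.
apply/seteqP; split=> [|g gB]; first exact: sub.
exists (mx2 d (- b) (- c) a *m g); last exact: mx2_adjK.
have hx' : val_ge 0 (u * (a * x + b)).
  by apply: val_geM hu (val_geD (val_geM ha hx _) hb) _.
have hu' : val_ge 0 (d + c * x) by apply: val_geD => //; exact: val_geM hc hx _.
have uE' : (d + c * x) * (a + - c * (u * (a * x + b))) = 1.
  have -> : (d + c * x) * (a + - c * (u * (a * x + b))) =
    a * (d + c * x) - c * (a * x + b) * (u * (d + c * x)) by ring.
  by rewrite uE mulr1 -E; ring.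
have := sub d (- b) (- c) a (u * (a * x + b)) (d + c * x).
have -> : (d + c * x) * (d * (u * (a * x + b)) + - b) = x.
  have -> : (d + c * x) * (d * (u * (a * x + b)) + - b) =
    d * (a * x + b) * (u * (d + c * x)) - b * (d + c * x) by ring.
  by rewrite uE mulr1 -[RHS]mul1r -E; ring.
apply; do ?[exact: val_geN | done | by rewrite -E; ring | by exists g].
Qed.

End Flags.

(** * Orbits of balls with integral center *)

Section Orbits.
Variable K : fieldType.
Local Notation L := (laurent K).
Local Notation t_ n := (monom (1 : K) n).
Implicit Types (x y z a b : L) (e c s n i j : int).

(** The relation a + d + t^2 (ad - bc) = 0 is exactly the determinant condition. *)
Lemma I4_sub_I3 : @I4 K `<=` I3.
Proof.
move=> _ [al [a [b [c [d [[ha hb hc hd] [al0 [E ->]]]]]]]].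
have alV : monom al 0 * monom al^-1 0 = 1 by rewrite monomM divff.
have diag (be : K) f : val_ge 0 f -> val_ge 0 (monom be 0 * (1 + t_ 2 * f)).
  move=> hf; apply: val_geM (val_ge_monom _ (lexx 0)) _ (lexx (0 + 0)).
  apply: val_geD; first exact: val_ge_monom.
  by apply/val_ge_tM; apply: val_geW hf.
apply/I3_mx2; split.
- have -> : monom al 0 * (1 + t_ 2 * a) * (monom al^-1 0 * (1 + t_ 2 * d))
    - t_ 2 * b * (t_ 2 * c) = (monom al 0 * monom al^-1 0 - 1) *
      (1 + t_ 2 * a) * (1 + t_ 2 * d) + 1 +
      t_ 2 * (a + d + t_ 2 * (a * d - b * c)) by ring.
  by rewrite alV E subrr !mul0r mulr0 add0r addr0.
- by apply: diag.
- by apply/val_ge_tM; rewrite subrr.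
- by apply/val_ge_tM; rewrite subrr.
- by apply: diag.
Qed.

(** Since the off-diagonal entries are divisible by t^2, the diagonal entries of
    a matrix in I_3 are units and the denominator of the Moebius transformation
    is one too. *)
Lemma act_I3 e c x (h : 'M[L]_2) : 0 <= e -> 1 <= c -> I3 h -> val_ge 0 x ->
  exists u a b, [/\ val_eq 0 u, val_eq 0 a, val_ge 2 b &
    act h (ball e c x) = ball e c (u * (a * x + b))].
Proof.
move=> e0 c0; move: h; apply: mx2P => a b c' d /I3_mx2[E ha hb hc hd] hx.
have hc0 : val_ge 0 c' by apply: val_geW hc.
have hb0 : val_ge 0 b by apply: val_geW hb.
have ad : a 0 * d 0 = 1.
  have := lcoefM_lead ha hd; rewrite addr0 => <-.
  have -> : a * d = 1 + b * c' by rewrite -E; ring.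
  by rewrite lcoefD (val_ge_coef (val_geM hb hc (l := 1) _)) // addr0 lcoef1.
have a0 : a 0 != 0 by apply/eqP => a0; move/eqP: ad; rewrite a0 mul0r eq_sym oner_eq0.
have d0 : d 0 != 0 by apply/eqP => d0; move/eqP: ad; rewrite d0 mulr0 eq_sym oner_eq0.
have hu : val_eq 0 (d + c' * x).
  by apply: val_eqDr; [|apply: val_geM hc hx _].
have [u [hu0 u0] uE] := val_eqV hu.
exists u, a, b; split=> //.
by apply: act_ball => //; rewrite mulrC.
Qed.

Lemma act_upper e c x y a a' b : 0 <= e -> 1 <= c -> a * a' = 1 -> val_ge 0 a ->
  val_ge 0 a' -> val_ge 0 b -> val_ge 0 x -> y = a * (a * x + b) ->
  act (mx2 a b 0 a') (ball e c x) = ball e c y.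
Proof.
move=> e0 c0 E ha ha' hb hx ->; apply: act_ball => //.
- by rewrite mulr0 subr0.
- by rewrite mul0r addr0.
Qed.

(** A constant diagonal matrix scales the center by al^2; whatever then differs
    from y is divisible by t^2 and can be reached by a translation. *)
Lemma I4_move e c x y (al : K) : 0 <= e -> 1 <= c -> al != 0 ->
  val_ge 0 x -> val_ge 2 (y - monom (al ^+ 2) 0 * x) ->
  orbit_of I4 (ball e c x) (ball e c y).
Proof.
move=> e0 c0 al0 hx hy.
have alV : monom al 0 * monom al^-1 0 = 1 by rewrite monomM divff.
have hm (be : K) : val_ge 0 (monom be 0) by exact: val_ge_monom.
pose b := monom al^-1 0 * (y - monom (al ^+ 2) 0 * x).
have hb : val_ge 2 b by apply: val_geM (hm _) hy _.
exists (mx2 (monom al 0) b 0 (monom al^-1 0)).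
  exists al, 0, (t_ (- 2) * b), 0, 0; split.
    by split=> //; apply/val_ge_tM.
  split=> //; split; first by ring.
  by rewrite tK !mulr0 !addr0 !mulr1.
apply: act_upper => //; first exact: val_geW hb.
rewrite /b -[in LHS](subrK (monom (al ^+ 2) 0 * x) y) mulrDr addrC; congr (_ + _).
  by rewrite mulrA monomM addr0.
by rewrite mulrA alV mul1r.
Qed.

Lemma I4_move_val2 e c y : 0 <= e -> 1 <= c -> val_ge 2 y ->
  orbit_of I4 (ball e c 0) (ball e c y).
Proof.
move=> e0 c0 hy; apply: (@I4_move _ _ _ _ 1) => //; first exact: oner_neq0.
by rewrite mulr0 subr0.
Qed.

Section BallOrbits.
Variables (e c : int).
Hypotheses (e0 : 0 <= e) (c0 : 1 <= c) (ec : e <= c <= e + 1).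

Lemma orbit_ball (P : set L) x0 : P x0 -> P `<=` val_ge 0 ->
  (forall u a b x, val_eq 0 u -> val_eq 0 a -> val_ge 2 b -> P x ->
    P (u * (a * x + b))) ->
  (forall y, P y -> orbit_of I3 (ball e c x0) (ball e c y)) ->
  is_orbit I3 (ball e c @` P).
Proof.
move=> Px0 P0 stab trans; exists (ball e c x0); first exact: flag_ball.
apply/seteqP; split=> [_ [y Py <-]|_ [h hI <-]]; first exact: trans.
have [u [a [b [hu ha hb ->]]]] := act_I3 e0 c0 hI (P0 _ Px0).
by exists (u * (a * x0 + b)) => //; exact: stab.
Qed.

Lemma stab_val i u a b x : i < 2 -> val_eq 0 u -> val_eq 0 a -> val_ge 2 b ->
  val_eq i x -> val_eq i (u * (a * x + b)).
Proof.
move=> i2 hu ha hb hx; rewrite -(add0r i); apply: val_eqM => //.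
apply: val_eqDr; last by apply: val_geW hb; lia.
by rewrite -(add0r i); apply: val_eqM.
Qed.

Lemma I4I3_orbit X : orbit_of I4 X `<=` orbit_of (@I3 K) X.
Proof. by move=> _ [h /I4_sub_I3 hI <-]; exists h. Qed.

Lemma orbit_val2 : is_orbit I3 (ball e c @` @val_ge K 2).
Proof.
apply: (orbit_ball (x0 := 0)); first by [].
- by move=> x hx; exact: val_geW hx.
- move=> u a b x [hu _] [ha _] hb hx.
  by apply: val_geM hu (val_geD (val_geM ha hx _) hb) _.
- by move=> y hy; apply: I4I3_orbit; exact: I4_move_val2.
Qed.

Hypothesis sqrtK : forall r : K, exists q : K, q ^+ 2 = r.

(** A square root of the ratio of the leading coefficients provides the constant
    diagonal matrix. *)
Lemma I4_move_val1 x y : val_eq 1 x -> val_eq 1 y ->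
  orbit_of I4 (ball e c x) (ball e c y).
Proof.
move=> [hx x1] [hy y1]; have [al alE] := sqrtK (y 1 / x 1).
apply: (@I4_move _ _ _ _ al) => //.
- by apply/eqP => al0; move/eqP: alE;
    rewrite al0 expr0n /= eq_sym mulf_eq0 invr_eq0 (negbTE x1) (negbTE y1).
- exact: val_geW hx.
- move=> k k2; rewrite lcoefB lcoef_monomM alE subr0.
  have [k1|->] : k < 1 \/ k = 1 by lia.
    by rewrite (hx k k1) (hy k k1) mulr0 subrr.
  by rewrite divfK // subrr.
Qed.

Lemma orbit_val1 : is_orbit I3 (ball e c @` @val_eq K 1).
Proof.
have t1 : val_eq 1 (t_ 1) by apply: val_eq_monom; exact: oner_neq0.
apply: (orbit_ball t1).
- by move=> x [hx _]; exact: val_geW hx.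
- by move=> u a b x; exact: stab_val.
- by move=> y hy; apply: I4I3_orbit; exact: I4_move_val1.
Qed.

Hypothesis two_neq0 : (2 : K) != 0.

(** The diagonal entry a = al + be t is chosen so that a^2 agrees with y modulo
    t^2; a translation corrects the rest.  The t-term, which requires dividing by
    2, is not available in I_4. *)
Lemma I3_move_unit y : val_eq 0 y ->
  orbit_of I3 (ball e c 1) (ball e c y).
Proof.
move=> [hy y0]; have [al alE] := sqrtK (y 0).
have al0 : al != 0.
  by apply/eqP => al0; move/eqP: alE; rewrite al0 expr0n /= eq_sym (negbTE y0).
(* al^2 is the constant term of y, and 2 al be its coefficient of t. *)
pose be := y 1 / (2 * al); pose a : L := monom al 0 + monom be 1.
have va : val_eq 0 a by apply: val_eqDr; [exact: val_eq_monom|exact: val_ge_monom].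
have [a' [ha' _] aa'] := val_eqV va; have [ha _] := va.
have r2 : val_ge 2 (y - a * a).
  have -> : a * a = monom (y 0) 0 + monom (y 1) 1 + monom (be * be) 2.
    have -> : a * a = monom al 0 * monom al 0 + (monom al 0 * monom be 1 +
       monom al 0 * monom be 1) + monom be 1 * monom be 1 by rewrite /a; ring.
    rewrite !monomM; congr (_ + _ + _); first by rewrite -alE.
    apply: laurentP => k /=; case: eqP => _; rewrite ?addr0 // /be.
    by field; rewrite al0 two_neq0.
  move=> k k2; rewrite !(lcoefB, lcoefD) /=.
  case: (ltP k 0) => k0.
    by rewrite hy //; do 3 (case: eqP => [?|_]; first lia); rewrite !addr0 subrr.
  have [->|->] : k = 0 \/ k = 1 by lia.
    by rewrite /= !addr0 subrr.
  by rewrite /= addr0 add0r subrr.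
exists (mx2 a (a' * (y - a * a)) 0 a').
  apply/I3_mx2; rewrite mulr0 subr0; split=> //.
  by apply: val_geM ha' r2 _.
apply: act_upper => //; first by apply: val_geM ha' r2 _.
- exact: val_ge_monom.
- have -> : a * (a * 1 + a' * (y - a * a)) = a * a + (a * a') * (y - a * a) by ring.
  by rewrite aa'; ring.
Qed.

Lemma orbit_val0 : is_orbit I3 (ball e c @` @val_eq K 0).
Proof.
apply: (orbit_ball (x0 := 1)).
- by apply: val_eq_monom; exact: oner_neq0.
- by move=> x [].
- by move=> u a b x; exact: stab_val.
- by move=> y; exact: I3_move_unit.
Qed.

End BallOrbits.

End Orbits.

(** * The Weyl element *)

Section Weyl.
Variable K : fieldType.
Local Notation L := (laurent K).
Local Notation t_ n := (monom (1 : K) n).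
Implicit Types (x y z a b : L) (e c s n i j : int).

(** As a Moebius transformation, this is x |-> -1/x. *)
Definition weyl : 'M[L]_2 := mx2 0 1 (- 1) 0.

Lemma act_act (g h : 'M[L]_2) X : act g (act h X) = act (g *m h) X.
Proof.
apply/seteqP; split=> [_ [_ [k Xk <-] <-]|_ [k Xk <-]].
  by exists k => //; rewrite mulmxA.
by exists (h *m k); [exists k|rewrite mulmxA].
Qed.

Lemma act_cosetI (g h : 'M[L]_2) : act g (cosetI h) = cosetI (g *m h).
Proof.
apply/seteqP; split=> [_ [_ [k Xk <-] <-]|_ [k Xk <-]].
  by exists k => //; rewrite mulmxA.
by exists (h *m k); [exists k|rewrite mulmxA].
Qed.

(** Conjugation by the Weyl element exchanges the diagonal entries, and the
    off-diagonal entries up to sign, so it preserves I_3. *)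
Lemma I3_weyl (h : 'M[L]_2) : I3 h ->
  exists h', [/\ I3 h', h *m weyl = weyl *m h' & h' *m weyl = weyl *m h].
Proof.
move: h; apply: mx2P => a b c d /I3_mx2[E ha hb hc hd].
exists (mx2 d (- c) (- b) a); split.
- by apply/I3_mx2; split; do ?exact: val_geN; rewrite // -E; ring.
- by rewrite !mulmx_mx2; congr mx2; ring.
- by rewrite !mulmx_mx2; congr mx2; ring.
Qed.

Lemma orbit_weyl (Y : set (set 'M[L]_2)) :
  is_orbit I3 Y -> is_orbit I3 (act weyl @` Y).
Proof.
move=> [x [g gSL <-] ->]; exists (act weyl (cosetI g)).
  rewrite act_cosetI; eexists; last by [].
  by rewrite /SL2 /= det_mulmx gSL det_mx2; ring.
apply/seteqP; split=> [_ [_ [h hI <-] <-]|_ [h hI <-]].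
  have [h' [hI' _ E]] := I3_weyl hI; exists h' => //.
  by rewrite !act_act E.
have [h' [hI' E _]] := I3_weyl hI; exists (act h' (cosetI g)); first by exists h'.
by rewrite !act_act E.
Qed.

Lemma act_weylP X (A B C D : L) :
  act weyl X (mx2 A B C D) <-> X (mx2 (- C) (- D) A B).
Proof.
split=> [[g + E]|hX].
  move: g E; apply: mx2P => p q r s; rewrite mulmx_mx2.
  move=> /mx2_inj[<- <- <- <-] hX.
  by congr (X (mx2 _ _ _ _)) : hX; ring.
by exists (mx2 (- C) (- D) A B) => //; rewrite mulmx_mx2; congr mx2; ring.
Qed.

(** The conditions that membership in a ball puts on one column (A, C), rewritten
    when the center y is replaced by its inverse z.  Over both columns
    of a matrix, the bounds on q + s say that the ball around y does not contain
    0, so that inversion maps it to a ball. *)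
Lemma val_ge_inv (A C y z : L) p q s :
  val_eq s y -> y * z = 1 -> val_eq (- s) z -> q + s <= p ->
  val_ge p (- C - y * A) /\ val_ge q A <->
  val_ge (p - s) (A - - z * C) /\ val_ge (q + s) C.
Proof.
move=> [hy _] yz [hz _] qsp; split=> -[h1 h2].
  split.
    have -> : A - - z * C = - z * (- C - y * A).
      by rewrite -[A in LHS]mul1r -yz; ring.
    by apply: val_geM (val_geN hz) h1 _; lia.
  have -> : C = - (- C - y * A) - y * A by ring.
  by apply: val_geB; [apply: val_geN; apply: val_geW h1|apply: val_geM hy h2 _; lia].
split.
  have -> : - C - y * A = - y * (A - - z * C).
    by rewrite -[C in LHS]mul1r -yz; ring.
  by apply: val_geM (val_geN hy) h1 _; lia.
have -> : A = (A - - z * C) - z * C by ring.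
by apply: val_geB; [apply: val_geW h1; lia|apply: val_geM hz h2 _; lia].
Qed.

Lemma act_weyl_ball e c s y z : e <= c <= e + 1 -> s < e + c -> val_eq s y ->
  val_eq (- s) z -> y * z = 1 -> act weyl (ball e c y) = ball (e - s) (c - s) (- z).
Proof.
move=> ec sec hy hz yz; apply: set_mx2P => A B C D.
apply: iff_trans (act_weylP _ _ _ _ _) _.
apply: (iff_trans (ball_mx2 _ _ _ _ _ _ _)).
apply: iff_trans (iff_sym (ball_mx2 _ _ _ _ _ _ _)).
have H1 : (1 - c) + s <= c by lia.
have H2 : - e + s <= e by lia.
have [I1 J1] := val_ge_inv A C hy yz hz H1; have [I2 J2] := val_ge_inv B D hy yz hz H2.
have -> : - C * B - - D * A = A * D - B * C by ring.
have -> : 1 - (c - s) = 1 - c + s by ring.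
have -> : - (e - s) = - e + s by ring.
split=> -[E h1 h2 h3 h4].
  by have [] := I1 (conj h1 h3); have [] := I2 (conj h2 h4).
by have [] := J1 (conj h1 h3); have [] := J2 (conj h2 h4).
Qed.

(** Inversion maps a ball around 0 to the complement of a ball around 0, which
    is why the parity of e + c changes. *)
Lemma act_weyl_ball0 e c : act weyl (ball e c 0) = ball (- e) (1 - c) 0.
Proof.
apply: set_mx2P => A B C D.
apply: iff_trans (act_weylP _ _ _ _ _) _.
apply: (iff_trans (ball_mx2 _ _ _ _ _ _ _)).
apply: iff_trans (iff_sym (ball_mx2 _ _ _ _ _ _ _)).
rewrite !mul0r !subr0 !val_geNE opprK subKr.
have -> : - C * B - - D * A = A * D - B * C by ring.
by split=> -[].
Qed.

Lemma weyl_val e c s : e <= c <= e + 1 -> s < e + c ->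
  act weyl @` (ball e c @` val_eq s) = ball (e - s) (c - s) @` val_eq (- s).
Proof.
move=> ec sec; apply/seteqP; split=> [_ [_ [y hy <-] <-]|_ [z hz <-]].
  have [z hz yz] := val_eqV hy; exists (- z); first exact: val_eqN.
  by rewrite (act_weyl_ball ec sec hy hz yz).
have [y hy yz] := val_eqV (val_eqN hz); rewrite opprK in hy.
exists (ball e c y); first by exists y.
by rewrite (act_weyl_ball ec sec hy (val_eqN hz)) ?opprK // mulrC.
Qed.

(** A center divisible by t^2 either vanishes up to the radius, or has a
    valuation s between 2 and the radius. *)
Lemma weyl_val2 e c : e <= c <= e + 1 ->
  act weyl @` (ball e c @` val_ge 2) =
  \bigcup_(s in [set s : int | 2 <= s < e + c]) (ball (e - s) (c - s) @` val_eq (- s))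
  `|` [set ball (- e) (1 - c) 0].
Proof.
move=> ec; apply/seteqP; split=> [_ [_ [y hy <-] <-]|X].
  have [hy0|[s sb hs]] := val_ge_eq (e + c) hy.
    right; rewrite -act_weyl_ball0; congr act.
    by apply/ball_eq => //; rewrite subr0.
  left; exists s => //; rewrite -weyl_val //; last by case/andP: sb.
  by exists (ball e c y) => //; exists y.
move=> [[s sb]|->].
  have /andP[s2 sec] : 2 <= s < e + c := sb.
  rewrite -weyl_val // => -[_ [y [hy _] <-] <-].
  by exists (ball e c y) => //; exists y => //; exact: val_geW hy.
by exists (ball e c 0); [exists 0|exact: act_weyl_ball0].
Qed.

(** Polynomials of bounded degree are representatives of Laurent series modulo a
    power of t; this is why the sets of polynomials in the strata exhaust all
    centers of a given valuation. *)
Lemma span_trunc i j x : val_ge i x -> exists2 p, span_t i j p & val_ge (j + 1) (x - p).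
Proof.
move=> hx; pose f k := if k <= j then x k else 0.
have fb : exists N : int, forall k : int, k < N -> f k = 0.
  by exists i => k ki; rewrite /f hx // if_same.
exists (Laurent fb).
  move=> k; rewrite /= /f; case: (ltP k i) => [/hx ->|ik] /=; first by rewrite if_same.
  by move=> /negbTE ->.
by move=> k kj; rewrite lcoefB /= /f ifT ?subrr //; lia.
Qed.

Lemma span_val_ge i j (p : L) : span_t i j p -> val_ge i p.
Proof. by move=> h k ki; apply: h; lia. Qed.

Lemma span_unit_val_eq i j (p : L) : span_t_unit i j p -> val_eq i p.
Proof. by move=> [/span_val_ge]. Qed.

Lemma span_unit_trunc i j x : i <= j -> val_eq i x ->
  exists2 p, span_t_unit i j p & val_ge (j + 1) (x - p).
Proof.
move=> ij hx; have [hx' _] := hx; have [p hp xp] := span_trunc j hx'.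
exists p => //; split=> //.
by have [] := val_eq_congr hx xp (_ : i < j + 1); first by lia.
Qed.

Lemma val_eq_t n i x : val_eq i x -> val_eq (n + i) (t_ n * x).
Proof. by apply: val_eqM; apply: val_eq_monom; exact: oner_neq0. Qed.

Lemma val_ge_t n i x : val_ge i x -> val_ge (n + i) (t_ n * x).
Proof. by move=> hx; apply: val_geM (val_ge_monom _ (lexx n)) hx _. Qed.

Lemma pts_image n (S P Q : set L) :
  S `<=` P -> (forall x, P x -> exists2 p, S p & val_ge n (x - p)) ->
  (forall x, P x -> Q (t_ n * x)) -> (forall y, Q y -> P (t_ (- n) * y)) ->
  pts n S = ball n n @` Q.
Proof.
move=> SP trunc PQ QP; apply/seteqP; split=> [_ [p Sp <-]|_ [y Qy <-]].
  by exists (t_ n * p); [exact/PQ/SP|rewrite pt_ball].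
have [p Sp hp] := trunc _ (QP _ Qy); exists p => //; rewrite pt_ball.
apply/ball_eq; first by lia.
rewrite -[y](tK n) -mulrBr -opprB mulrN; apply: val_geN; exact: val_ge_t.
Qed.

Lemma pts'_image n (S P Q : set L) :
  S `<=` P -> (forall x, P x -> exists2 p, S p & val_ge (n + 1) (x - p)) ->
  (forall x, P x -> Q (- (t_ n * x))) -> (forall y, Q y -> P (- (t_ (- n) * y))) ->
  pts' n S = ball n (n + 1) @` Q.
Proof.
move=> SP trunc PQ QP; apply/seteqP; split=> [_ [p Sp <-]|_ [y Qy <-]].
  by exists (- (t_ n * p)); [exact/PQ/SP|rewrite pt'_ball].
have [p Sp hp] := trunc _ (QP _ Qy); exists p => //; rewrite pt'_ball.
apply/ball_eq; first by lia.
have -> : - (t_ n * p) - y = t_ n * (- (t_ (- n) * y) - p).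
  by rewrite -[y in LHS](tK n); ring.
exact: val_ge_t.
Qed.

Lemma pts_span n i j s : n = j + 1 -> n + i = s ->
  pts n (@span_t K i j) = ball n n @` val_ge s.
Proof.
move=> nj <-; apply: (@pts_image n _ (val_ge i)).
- by move=> p /span_val_ge.
- by rewrite nj => x /(@span_trunc _ j).
- by move=> x; exact: val_ge_t.
- by move=> y /(@val_ge_t (- n) _ _); rewrite addKr.
Qed.

Lemma pts_span_unit n i j s : n = j + 1 -> n + i = s -> i <= j ->
  pts n (@span_t_unit K i j) = ball n n @` val_eq s.
Proof.
move=> nj <- ij; apply: (@pts_image n _ (val_eq i)).
- by move=> p /span_unit_val_eq.
- by rewrite nj => x /(@span_unit_trunc _ j); apply.
- by move=> x; exact: val_eq_t.
- by move=> y /(val_eq_t (- n)); rewrite addKr.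
Qed.

Lemma pts'_span n i s : n + i = s ->
  pts' n (@span_t K i n) = ball n (n + 1) @` val_ge s.
Proof.
move=> <-; apply: (@pts'_image n _ (val_ge i)).
- by move=> p /span_val_ge.
- by move=> x /(@span_trunc _ n _).
- by move=> x hx; apply: val_geN; exact: val_ge_t.
- by move=> y /(@val_ge_t (- n) _ _); rewrite addKr => /val_geN.
Qed.

Lemma pts'_span_unit n i s : n + i = s -> i <= n ->
  pts' n (@span_t_unit K i n) = ball n (n + 1) @` val_eq s.
Proof.
move=> <- ni; apply: (@pts'_image n _ (val_eq i)).
- by move=> p /span_unit_val_eq.
- by move=> x /(@span_unit_trunc _ n); apply.
- by move=> x hx; apply: val_eqN; exact: val_eq_t.
- by move=> y /(val_eq_t (- n)); rewrite addKr => /val_eqN.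
Qed.

End Weyl.

(** * Regular functions *)

Section RegularFunctions.
Variables (K : fieldType) (m : nat) (T : set 'rV[K]_m).
Implicit Types f g : 'rV[K]_m -> K.

Lemma regular_ext f g : (forall x, T x -> f x = g x) ->
  regular_fun T f -> regular_fun T g.
Proof.
move=> fg hf x Tx; have [p [q [qx pqE]]] := hf x Tx; exists p, q; split=> // y Ty qy.
by rewrite -fg // pqE.
Qed.

Lemma regular_poly (p : {mpoly K[m]}) : regular_fun T (fun x => p.@[x 0]).
Proof.
move=> x _; exists p, 1; rewrite /principal_open /=; split=> [|y _ _].
  by rewrite meval1 oner_eq0.
by rewrite meval1 divr1.
Qed.

Lemma regular_cst (r : K) : regular_fun T (fun=> r).
Proof.
by apply: regular_ext (regular_poly r%:MP_[m]) => x _; rewrite mevalC.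
Qed.

Lemma regular_coord i : regular_fun T (fun x => x 0 i).
Proof.
by apply: regular_ext (regular_poly 'X_i) => x _; rewrite mevalXU.
Qed.

Lemma regularD f g : regular_fun T f -> regular_fun T g ->
  regular_fun T (fun x => f x + g x).
Proof.
move=> hf hg x Tx; have [p [q [qx fE]]] := hf x Tx; have [r [s [sx gE]]] := hg x Tx.
exists (p * s + r * q), (q * s); rewrite /principal_open /= mevalM in qx sx *.
split=> [|y Ty]; first exact: mulf_neq0.
rewrite mevalM mulf_eq0 negb_or => /andP[qy sy].
by rewrite fE // gE // mevalD !mevalM; field; rewrite qy sy.
Qed.

Lemma regularM f g : regular_fun T f -> regular_fun T g ->
  regular_fun T (fun x => f x * g x).
Proof.
move=> hf hg x Tx; have [p [q [qx fE]]] := hf x Tx; have [r [s [sx gE]]] := hg x Tx.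
exists (p * r), (q * s); rewrite /principal_open /= mevalM in qx sx *.
split=> [|y Ty]; first exact: mulf_neq0.
rewrite mevalM mulf_eq0 negb_or => /andP[qy sy].
by rewrite fE // gE // !mevalM; field; rewrite qy sy.
Qed.

Lemma regularN f : regular_fun T f -> regular_fun T (fun x => - f x).
Proof.
move=> /(regularM (regular_cst (- 1))); apply: regular_ext => x _.
by rewrite mulN1r.
Qed.

Lemma regular_sum (I : Type) (r : seq I) (F : I -> 'rV[K]_m -> K) :
  (forall i, regular_fun T (F i)) -> regular_fun T (fun x => \sum_(i <- r) F i x).
Proof.
move=> hF; elim: r => [|i r IH].
  by apply: regular_ext (regular_cst 0) => x _; rewrite big_nil.
by apply: regular_ext (regularD (hF i) IH) => x _; rewrite big_cons.
Qed.

Lemma regularV f : (forall x, T x -> f x != 0) -> regular_fun T f ->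
  regular_fun T (fun x => (f x)^-1).
Proof.
move=> f0 hf x Tx; have [p [q [qx fE]]] := hf x Tx.
have := f0 x Tx; rewrite fE // mulf_eq0 negb_or => /andP[px _].
exists (q * q), (p * q); rewrite /principal_open /= mevalM in qx *.
split=> [|y Ty]; first exact: mulf_neq0.
rewrite mevalM mulf_eq0 negb_or => /andP[py qy].
by rewrite fE // !mevalM; field; rewrite py qy.
Qed.

End RegularFunctions.

(** Restricting the local fraction p/r to the principal open set of q amounts to
    writing it as p q / (r q). *)
Lemma regular_local (K : fieldType) m (T : set 'rV[K]_m) (f : 'rV[K]_m -> K) :
  (forall x, T x -> exists2 q, principal_open q x &
    regular_fun (T `&` principal_open q) f) -> regular_fun T f.
Proof.
move=> loc x Tx; have [q qx hf] := loc x Tx.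
have [p [r [rx fE]]] := hf x (conj Tx qx).
exists (p * q), (r * q); rewrite /principal_open /= in qx rx *.
split=> [|y Ty]; first by rewrite mevalM mulf_neq0.
rewrite mevalM mulf_eq0 negb_or => /andP[ry qy].
by rewrite fE // !mevalM; field; rewrite ry qy.
Qed.

(** * Coordinates on sets of balls *)

Section Coordinates.
Variable K : fieldType.
Local Notation L := (laurent K).
Local Notation t_ n := (monom (1 : K) n).
Implicit Types (e c i : int).

(** The center of a ball with coordinates z_0, ..., z_(d-1), starting in degree i. *)
Definition coord_series i d (z : 'rV[K]_d) : L := \sum_(l < d) monom (z 0 l) (i + l%:Z).

Lemma coef_coord_series i d (z : 'rV[K]_d) (l : 'I_d) :
  coord_series i z (i + l%:Z) = z 0 l.
Proof.
rewrite /coord_series lcoef_sum (bigD1 l) //= eqxx big1 ?addr0 // => k kl.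
case: eqP => // E; case/eqP: kl; apply/val_inj => /=; lia.
Qed.

Lemma coord_series_val_ge i d (z : 'rV[K]_d) : val_ge i (coord_series i z).
Proof.
move=> k ki; rewrite /coord_series lcoef_sum big1 // => l _ /=.
by case: eqP => // E; lia.
Qed.

Lemma regular_coord_series m (T : set 'rV[K]_m) i k :
  regular_fun T (fun z => coord_series i z k).
Proof.
have H : regular_fun T (fun z => \sum_(l < m) if k == i + l%:Z then z 0 l else 0).
  apply: regular_sum => l; case: eqP => _; [exact: regular_coord|exact: regular_cst].
by apply: regular_ext H => z _; rewrite /coord_series lcoef_sum.
Qed.

Lemma coord_series_ex i d (x : L) : val_ge i x ->
  exists2 z : 'rV[K]_d, (forall l : 'I_d, z 0 l = x (i + l%:Z)) &
    val_ge (i + d%:Z) (coord_series i z - x).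
Proof.
move=> hx; exists (\row_l x (i + l%:Z)) => [l|k kd]; first by rewrite mxE.
rewrite lcoefB; case: (ltP k i) => ki.
  by rewrite coord_series_val_ge // hx // subrr.
have ld : (`|k - i| < d)%N by lia.
have -> : k = i + (Ordinal ld : nat)%:Z by rewrite /=; lia.
by rewrite coef_coord_series mxE subrr.
Qed.

(** In one of the two columns, the second one when c = e and the first one
    otherwise, the entries can be divided up to the full radius: were the
    valuation of the bottom entry larger than - e, the determinant would be
    divisible by t. *)
Lemma ball_pivot e c (x : L) (g : 'M[L]_2) : e <= c <= e + 1 -> ball e c x g ->
  let j : 'I_2 := if c == e then 1 else 0 in
  val_ge c (g 0 j - x * g 1 j) /\ val_eq (- e) (g 1 j).
Proof.
move=> ec; move: g; apply: mx2P => A B C D /ball_mx2[E hA hB hC hD].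
have lead (f : L) n : val_ge n f -> (val_ge (n + 1) f -> False) -> val_eq n f.
  move=> hf H; split=> //; apply/eqP => f0; apply: H => k kn.
  have [kn'|->] : k < n \/ k = n by lia.
    exact: hf.
  exact: f0.
have det1 : (A - x * C) * D - (B - x * D) * C = 1 by rewrite -E; ring.
have det_lt : val_ge 1 ((A - x * C) * D - (B - x * D) * C) -> False.
  rewrite det1 => /(_ 0 isT)/eqP; by rewrite lcoef1 oner_eq0.
have [m1 m2 m3 m4] := mx2E A B C D.
case: eqP => ce /=; rewrite ?m1 ?m2 ?m3 ?m4; split.
- by rewrite ce.
- apply: lead => // hD'; apply: det_lt; apply: val_geB.
    by apply: val_geM hA hD' _; lia.
  by apply: val_geM hB hC _; lia.
- by [].
- have hC' : val_ge (- e) C by apply: val_geW hC; lia.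
  apply: lead => // hC''; apply: det_lt; apply: val_geB.
    by apply: val_geM hA hD _; lia.
  by apply: val_geM hB hC'' _; lia.
Qed.

(** The coordinates form a global section of SL_2((t)) -> SL_2((t))/I over the
    set of balls.  Conversely, the center is recovered from any local lift g by
    long division of the entries of the pivot column, whose steps only divide by
    the coefficient of t^(-e) in the pivot entry. *)
Lemma iso_ball e c i d (X : set 'rV[K]_d) : e <= c <= e + 1 -> e + c = i + d%:Z ->
  isomorphic_to ((fun z => ball e c (coord_series i z)) @` X) X.
Proof.
move=> ec ecd; pose phi (z : 'rV[K]_d) := ball e c (coord_series i z).
exists phi; split.
- split=> [z Xz|z z' _ _ /(ball_eq _ _ ec) zz'|_ [z Xz <-]]; [by exists z| |by exists z].
  apply/rowP => l; rewrite -!(coef_coord_series i); apply/eqP; rewrite -subr_eq0 -lcoefB.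
  apply/eqP; apply: zz'; have := ltn_ord l; lia.
- pose g (z : 'rV[K]_d) : 'M[L]_2 :=
    if c == e then mx2 (t_ e) (t_ (- e) * coord_series i z) 0 (t_ (- e))
    else mx2 (- (t_ (- e) * coord_series i z)) (t_ e) (- t_ (- e)) 0.
  move=> z0 _; exists 1, g; split; first by rewrite /principal_open /= meval1 oner_neq0.
    pose N : int := - `|e| - `|i|.
    have N1 : val_ge N (t_ e) by apply: val_ge_monom; lia.
    have N2 : val_ge N (t_ (- e)) by apply: val_ge_monom; lia.
    have N3 (z : 'rV[K]_d) : val_ge N (t_ (- e) * coord_series i z).
      by apply: val_geM (val_ge_monom _ (lexx (- e))) (@coord_series_val_ge i d z) _; lia.
    have g2 (P : L -> Prop) z a b : P (t_ e) -> P (t_ (- e)) -> P (- t_ (- e)) ->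
        P (t_ (- e) * coord_series i z) -> P (- (t_ (- e) * coord_series i z)) ->
        P 0 -> P (g z a b).
      by rewrite /g; case: eqP => _; rewrite mxE; case: ifP => _; case: ifP.
    split.
    + move=> _ [z _ <-]; rewrite /SL2 /g /=; case: eqP => _; rewrite det_mx2.
        by rewrite tVM mulr0 subr0.
      by rewrite mulr0 mulrN tVM sub0r opprK.
    + exists N => z a b k _ kN; apply: (g2 (fun f => f k = 0)) => //;
        by [apply: N1|apply: N2|apply: val_geN kN|apply: N3|apply: (val_geN (N3 z))].
    + move=> a b k.
      have reg_s : regular_fun (X `&` principal_open 1)
          (fun z => (t_ (- e) * coord_series i z) k).
        apply: (@regular_ext _ _ _ (fun z => coord_series i z (k - - e))) => [z _|].
          by rewrite lcoef_monomM mul1r.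
        exact: regular_coord_series.
      pose s (z : 'rV[K]_d) := t_ (- e) * coord_series i z.
      apply: (@regular_ext _ _ _ (fun z => (if c == e
          then if a == 0 then if b == 0 then t_ e else s z
               else if b == 0 then 0 else t_ (- e)
          else if a == 0 then if b == 0 then - s z else t_ e
               else if b == 0 then - t_ (- e) else 0) k)).
        by move=> z _; rewrite /g; case: eqP => _; rewrite mxE.
      by case: (c == e); case: (a == 0); case: (b == 0);
        do ?[exact: reg_s|exact: regularN|exact: regular_cst].
  move=> z _ _; rewrite /phi /g; case: eqP => ce.
    by rewrite (ball_pt _ ce).
  by rewrite ball_pt'; last by lia.
- move=> k T psi _ psiM psiY.
  have /choice[f fP] (x : 'rV[K]_k) : exists z, T x -> X z /\ phi z = psi x.
    have [Tx|nTx] := pselect (T x); last by exists 0.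
    by have [|z Xz zE] := psiY (psi x); [exists x|exists z].
  exists f; last by move=> x /fP[_ ->].
  split=> [_ [x Tx <-]|l]; first by have [] := fP x Tx.
  apply: regular_local => x Tx; have [q [g [qx [_ _ greg] gE]]] := psiM x Tx.
  (* The pivot column of the lift determines the coordinates. *)
  exists q => //; set T' := T `&` principal_open q in greg *.
  pose j : 'I_2 := if c == e then 1 else 0.
  have piv y : T' y -> val_ge c (g y 0 j - coord_series i (f y) * g y 1 j) /\
      val_eq (- e) (g y 1 j).
    move=> [Ty qy]; apply: ball_pivot => //; rewrite -/(phi (f y)).
    by have [_ ->] := fP y Ty; rewrite gE //; exact: cosetI_refl.
  have reg (n : nat) : (n < d)%N ->
      regular_fun T' (fun y => coord_series i (f y) (i + n%:Z)).
    elim/ltn_ind: n => n IH nd.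
    (* The coefficient of t^(i-e+n) in g_0j = x g_1j, solved for the newest
       coefficient of x; i - e + n lies below the precision c since n < d. *)
    have rec y : T' y ->
        (g y 0 j (i - e + n%:Z) - \sum_(a < n) coord_series i (f y) (i + a%:Z)
          * g y 1 j (- e + n%:Z - a%:Z)) * (g y 1 j (- e))^-1
        = coord_series i (f y) (i + n%:Z).
      move=> /piv[h1 [h2 h3]].
      have := h1 (i - e + n%:Z); rewrite lcoefB => /(_ _)/eqP.
      rewrite subr_eq0 (lcoefM_val_ge _ (@coord_series_val_ge i d (f y)) h2).
      rewrite big_ord_recr /=.
      move=> /(_ _)/eqP ->; last by lia.
      by rewrite [X in X - _]addrC addrK [- e + _ - _]addrK mulfK.
    apply: regular_ext rec _.
    apply: regularM; last by apply: regularV => // y /piv[_ []].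
    apply: regularD => //; apply: regularN; apply: regular_sum => a.
    by apply: regularM => //; apply: IH => //; have := ltn_ord a; lia.
  by apply: regular_ext (reg l (ltn_ord l)) => y _; rewrite coef_coord_series.
Qed.

Lemma iso_val_ge e c i d : e <= c <= e + 1 -> e + c = i + d%:Z ->
  isomorphic_to (ball e c @` @val_ge K i) (affine_space d).
Proof.
move=> ec ecd.
have -> : ball e c @` @val_ge K i =
    (fun z => ball e c (coord_series i z)) @` affine_space d.
  apply/seteqP; split=> [_ [x hx <-]|_ [z _ <-]].
    have [z _ hz] := coord_series_ex d hx; exists z => //.
    by apply/ball_eq => //; rewrite ecd.
  by exists (coord_series i z) => //; exact: coord_series_val_ge.
exact: iso_ball.
Qed.

Lemma iso_val_eq e c i d : e <= c <= e + 1 -> e + c = i + 1 + d%:Z ->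
  isomorphic_to (ball e c @` @val_eq K i) (prod_var Gm (affine_space d)).
Proof.
move=> ec ecd.
have lead (z : 'rV[K]_(1 + d)) : lsubmx z 0 0 = coord_series i z i.
  by rewrite mxE -(coef_coord_series i) /= addr0.
have -> : ball e c @` @val_eq K i =
    (fun z => ball e c (coord_series i z)) @` prod_var Gm (affine_space d).
  apply/seteqP; split=> [_ [x [hx x0] <-]|_ [z [z0 _] <-]].
    have [z zE hz] := coord_series_ex (1 + d) hx; exists z.
      split=> //; by rewrite /Gm /= mxE zE /= addr0.
    by apply/ball_eq => //; rewrite ecd -addrA.
  exists (coord_series i z) => //; split; first exact: coord_series_val_ge.
  by rewrite -lead.
by apply: iso_ball => //; rewrite ecd -addrA.
Qed.

End Coordinates.

(** * The strata *)

Lemma ball_val1_setU (K : fieldType) (e c : int) :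
  ball e c @` @val_ge K 1 = (ball e c @` @val_eq K 1) `|` (ball e c @` @val_ge K 2).
Proof.
rewrite -image_setU; congr (_ @` _); apply/seteqP; split=> x.
  move=> hx; have [hx2|[s s12 hs]] := val_ge_eq 2 hx; first by right.
  by left; rewrite (_ : 1 = s) //; lia.
by move=> [[]//|]; apply: val_geW.
Qed.

Lemma ball_val1_setI (K : fieldType) (e c : int) : e <= c <= e + 1 -> 2 <= e + c ->
  (ball e c @` @val_eq K 1) `&` (ball e c @` @val_ge K 2) = set0.
Proof.
move=> ec ec2; apply/seteqP; split=> // _ [[x hx <-] [y hy /(ball_eq _ _ ec) yx]].
have [_] : val_eq 1 y.
  apply: val_eq_congr hx (_ : val_ge (e + c) _) _; last lia.
  by rewrite -opprB; exact: val_geN.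
by rewrite hy ?eqxx.
Qed.

Section Strata.
Variable K : fieldType.
Implicit Type n : int.

Lemma EoE n : 0 < n -> Eo K n = ball n n @` @val_eq K 0.
Proof. by move=> n0; rewrite /Eo n0; apply: pts_span_unit; lia. Qed.

Lemma OoE n : 0 <= n -> Oo K n = ball n (n + 1) @` @val_eq K 0.
Proof. by move=> n0; rewrite /Oo n0; apply: pts'_span_unit; lia. Qed.

Lemma EhE n : 0 < n -> Eh K n = ball n n @` @val_ge K 1.
Proof. by move=> n0; rewrite /Eh n0; apply: pts_span; lia. Qed.

Lemma OhE n : 0 < n -> Oh K n = ball n (n + 1) @` @val_ge K 1.
Proof. by move=> n0; rewrite /Oh (ltW n0); apply: pts'_span; lia. Qed.

Lemma EhoE n : 0 < n -> Eho K n = ball n n @` @val_eq K 1.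
Proof. by move=> n0; apply: pts_span_unit; lia. Qed.

Lemma EhhE n : Ehh K n = ball n n @` @val_ge K 2.
Proof. by apply: pts_span; lia. Qed.

Lemma OhoE n : 0 < n -> Oho K n = ball n (n + 1) @` @val_eq K 1.
Proof. by move=> n0; apply: pts'_span_unit; lia. Qed.

Lemma OhhE n : Ohh K n = ball n (n + 1) @` @val_ge K 2.
Proof. by apply: pts'_span; lia. Qed.

(** The strata with negative index, as images under the Weyl element of sets of
    balls of radius - 2n + 1 (E family) or - 2n (O family). *)
Lemma EoNE n : n < 0 ->
  Eo K n = act (weyl K) @` (ball (- n) (- n + 1) @` @val_eq K 1).
Proof.
move=> n0; rewrite /Eo ltNge (ltW n0) /= weyl_val; [|lia..].
have -> : - n + 1 - 1 = - n - 1 + 1 by lia.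
by apply: pts'_span_unit; lia.
Qed.

Lemma OoNE n : n < 0 ->
  Oo K n = act (weyl K) @` (ball (- n) (- n) @` @val_eq K 1).
Proof.
move=> n0; rewrite /Oo leNgt n0 /= weyl_val; [|lia..].
by apply: pts_span_unit; lia.
Qed.

(** The piece of the union with index k consists of the balls whose inverse has
    valuation s = k + 1. *)
Lemma EhNE n : n < 0 ->
  Eh K n = act (weyl K) @` (ball (- n) (- n + 1) @` @val_ge K 2).
Proof.
move=> n0; rewrite /Eh ltNge (ltW n0) /= weyl_val2; last by lia.
congr (_ `|` _); last first.
  by rewrite pt_ball mulr0; congr [set ball _ _ _]; lia.
have term k s : s = k + 1 -> 1 <= k <= - 2 * n - 1 ->
    pts' (- n - 1 - k) (@span_t_unit K n (- n - 1 - k)) =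
    ball (- n - s) (- n + 1 - s) @` val_eq (- s).
  move=> -> kb; have -> : - n - (k + 1) = - n - 1 - k by lia.
  have -> : - n + 1 - (k + 1) = - n - 1 - k + 1 by lia.
  by apply: pts'_span_unit; lia.
apply/seteqP; split=> [X [k kb hX]|X [s sb hX]].
  exists (k + 1); first by move: kb => /=; lia.
  by rewrite -(term k).
have sb' : 2 <= s < - n + (- n + 1) := sb.
have kb : 1 <= s - 1 <= - 2 * n - 1 by lia.
by exists (s - 1) => //; rewrite (term _ s) //; lia.
Qed.

Lemma OhNE n : n < 0 ->
  Oh K n = act (weyl K) @` (ball (- n) (- n) @` @val_ge K 2).
Proof.
move=> n0; rewrite /Oh leNgt n0 /= weyl_val2; last by lia.
congr (_ `|` _); last first.
  by rewrite pt'_ball mulr0 oppr0; congr [set ball _ _ _]; lia.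
have term k s : s = k + 1 -> 1 <= k <= - 2 * n - 2 ->
    pts (- n - 1 - k) (@span_t_unit K n (- n - 2 - k)) =
    ball (- n - s) (- n - s) @` val_eq (- s).
  move=> -> kb; have -> : - n - (k + 1) = - n - 1 - k by lia.
  by apply: pts_span_unit; lia.
apply/seteqP; split=> [X [k kb hX]|X [s sb hX]].
  exists (k + 1); first by move: kb => /=; lia.
  by rewrite -(term k).
have sb' : 2 <= s < - n + - n := sb.
have kb : 1 <= s - 1 <= - 2 * n - 2 by lia.
by exists (s - 1) => //; rewrite (term _ s) //; lia.
Qed.

Hypothesis sqrtK : forall r : K, exists q : K, q ^+ 2 = r.
Hypothesis two_neq0 : (2 : K) != 0.

Lemma Eo_orbit n : n != 0 -> is_orbit I3 (Eo K n).
Proof.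
move=> n0; have [np|nn] : 0 < n \/ n < 0 by lia.
  by rewrite EoE //; apply: orbit_val0 => //; lia.
by rewrite EoNE //; apply/orbit_weyl/orbit_val1 => //; lia.
Qed.

Lemma Oo_orbit n : is_orbit I3 (Oo K n).
Proof.
have [np|nn] : 0 <= n \/ n < 0 by lia.
  by rewrite OoE //; apply: orbit_val0 => //; lia.
by rewrite OoNE //; apply/orbit_weyl/orbit_val1 => //; lia.
Qed.

Lemma Eh_orbit n : n < 0 -> is_orbit I3 (Eh K n).
Proof. by move=> nn; rewrite EhNE //; apply/orbit_weyl/orbit_val2 => //; lia. Qed.

Lemma Oh_orbit n : n < 0 -> is_orbit I3 (Oh K n).
Proof. by move=> nn; rewrite OhNE //; apply/orbit_weyl/orbit_val2 => //; lia. Qed.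

Lemma Eh_decomposition n : 0 < n ->
  [/\ Eh K n = Eho K n `|` Ehh K n, Eho K n `&` Ehh K n = set0,
      is_orbit I3 (Eho K n) & is_orbit I3 (Ehh K n)].
Proof.
move=> n0; rewrite EhE // EhoE // EhhE; split.
- exact: ball_val1_setU.
- by apply: ball_val1_setI; lia.
- by apply: orbit_val1 => //; lia.
- by apply: orbit_val2; lia.
Qed.

Lemma Oh_decomposition n : 0 < n ->
  [/\ Oh K n = Oho K n `|` Ohh K n, Oho K n `&` Ohh K n = set0,
      is_orbit I3 (Oho K n) & is_orbit I3 (Ohh K n)].
Proof.
move=> n0; rewrite OhE // OhoE // OhhE; split.
- exact: ball_val1_setU.
- by apply: ball_val1_setI; lia.
- by apply: orbit_val1 => //; lia.
- by apply: orbit_val2; lia.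
Qed.

Lemma Eh_pieces n : 0 < n ->
  [/\ isomorphic_to (Eho K n) (prod_var Gm (affine_space (absz (2 * n - 2)%R))),
      isomorphic_to (Ehh K n) (affine_space (absz (2 * n - 2)%R)),
      Eho K n `<=` orbit_of I4 (pt n (monom 1 (- n + 1)))
    & Ehh K n `<=` orbit_of I4 (pt n 0)].
Proof.
move=> n0; rewrite EhoE // EhhE !pt_ball tM mulr0.
have -> : n + (- n + 1) = 1 by lia.
split.
- by apply: iso_val_eq; lia.
- by apply: iso_val_ge; lia.
- move=> _ [y hy <-]; apply: I4_move_val1 => //; [lia..|].
  by apply: val_eq_monom; exact: oner_neq0.
- by move=> _ [y hy <-]; apply: I4_move_val2 => //; lia.
Qed.

Lemma Oh_pieces n : 0 < n ->
  [/\ isomorphic_to (Oho K n) (prod_var Gm (affine_space (absz (2 * n - 1)%R))),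
      isomorphic_to (Ohh K n) (affine_space (absz (2 * n - 1)%R)),
      Oho K n `<=` orbit_of I4 (pt' n (monom 1 (- n + 1)))
    & Ohh K n `<=` orbit_of I4 (pt' n 0)].
Proof.
move=> n0; rewrite OhoE // OhhE !pt'_ball tM mulr0 oppr0.
have -> : n + (- n + 1) = 1 by lia.
split.
- by apply: iso_val_eq; lia.
- by apply: iso_val_ge; lia.
- move=> _ [y hy <-]; apply: I4_move_val1 => //; [lia..|].
  by apply/val_eqN/val_eq_monom; exact: oner_neq0.
- by move=> _ [y hy <-]; apply: I4_move_val2 => //; lia.
Qed.

End Strata.

Theorem proposition6p1 (R : realType) :
  let C : fieldType := R[i]%C in
  ((forall n : int, n != 0 -> is_orbit I3 (Eo C n)) /\
   (forall n : int, n < 0 -> is_orbit I3 (Eh C n))) /\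
  ((forall n : int, is_orbit I3 (Oo C n)) /\
   (forall n : int, n < 0 -> is_orbit I3 (Oh C n))) /\
  (forall n : int, 0 < n ->
     [/\ Eh C n = Eho C n `|` Ehh C n, Eho C n `&` Ehh C n = set0,
         is_orbit I3 (Eho C n) & is_orbit I3 (Ehh C n)] /\
     [/\ isomorphic_to (Eho C n) (prod_var Gm (affine_space (absz (2 * n - 2)%R))),
         isomorphic_to (Ehh C n) (affine_space (absz (2 * n - 2)%R)),
         Eho C n `<=` orbit_of I4 (pt n (monom 1 (- n + 1)))
       & Ehh C n `<=` orbit_of I4 (pt n 0)]) /\
  (forall n : int, 0 < n ->
     [/\ Oh C n = Oho C n `|` Ohh C n, Oho C n `&` Ohh C n = set0,
         is_orbit I3 (Oho C n) & is_orbit I3 (Ohh C n)] /\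
     [/\ isomorphic_to (Oho C n) (prod_var Gm (affine_space (absz (2 * n - 1)%R))),
         isomorphic_to (Ohh C n) (affine_space (absz (2 * n - 1)%R)),
         Oho C n `<=` orbit_of I4 (pt' n (monom 1 (- n + 1)))
       & Ohh C n `<=` orbit_of I4 (pt' n 0)]).
Proof.
move=> C.
(* Algebraic closedness and characteristic 0 enter through these two facts. *)
have sqrtK (r : C) : exists q : C, q ^+ 2 = r.
  by exists (sqrtc r); exact: sqr_sqrtc.
have two_neq0 : (2 : C) != 0 by rewrite pnatr_eq0.
split; first by split=> n; [exact: Eo_orbit|exact: Eh_orbit].
split; first by split=> n; [exact: Oo_orbit|exact: Oh_orbit].
split=> n n0.
  by split; [exact: Eh_decomposition|exact: Eh_pieces].
by split; [exact: Oh_decomposition|exact: Oh_pieces].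
Qed.
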